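(* Let $(\mathfrak g,[-,-],(-)^{[p]},R)$ be a restricted Rota-Baxter Lie algebra of weight $1$ over $\mathbf k$. Then the Rota-Baxter operator $R$ on the Hopf algebra $\mathrm U(\mathfrak g)$ extending $R$ descends to a Rota-Baxter operator on the restricted enveloping algebra $\mathrm u(\mathfrak g)=\mathrm U(\mathfrak g)/(x^p-x^{[p]}\mid x\in\mathfrak g)$. Furthermore, if $R$ is idempotent on $\mathfrak g$ and $\mathbf k$ is not of characteristic $2$, then this Rota-Baxter operator on $\mathrm u(\mathfrak g)$ is a Hopf algebra endomorphism of $\mathrm u(\mathfrak g)$.
   Context: Convention: $\mathbf k$ is an algebraically closed field of prime characteristic $p$; everything is over $\mathbf k$. Rota-Baxter operator of weight $\lambda$ on a Lie algebra: a linear map $R$ such that $[R(x),R(y)]=R([R(x),y])+R([x,R(y)])+\lambda R([x,y])$ for all $x,y$. Rota-Baxter operator on a cocommutative Hopf algebra $H$ (with antipode $S$): a coalgebra endomorphism $R$ of $H$ such that $R(x)R(y)=R(x_1R(x_2)\,y\,S(R(x_3)))$ for all $x,y\in H$ (Sweedler notation). Extension to $\mathrm U(\mathfrak g)$ (Goncharov): a Rota-Baxter operator $R$ of weight $1$ on $\mathfrak g$ extends to a well-defined Rota-Baxter operator on the Hopf algebra $\mathrm U(\mathfrak g)$ (elements of $\mathfrak g$ primitive), determined by $R(1)=1$ and $R(xy)=R(x)R(y)-R([R(x),y])$ for $x\in\mathfrak g$, $y\in\mathrm U(\mathfrak g)$ (commutator in $\mathrm U(\mathfrak g)$). Restricted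 Lie algebra: a Lie algebra $(\mathfrak g,[-,-])$ with a $p$-map $(-)^{[p]}:\mathfrak g\to\mathfrak g$ satisfying $(ax)^{[p]}=a^px^{[p]}$ for $a\in\mathbf k$, $[x^{[p]},y]=(\mathrm{ad}_x)^p(y)$, and $(x+y)^{[p]}=x^{[p]}+y^{[p]}+\sum_{i=1}^{p-1}s_i(x,y)$, where $i\,s_i(x,y)$ is the coefficient of $t^{i-1}$ in $(\mathrm{ad}_{tx+y})^{p-1}(x)\in\mathbf k[t]\otimes\mathfrak g$. For a composition $\alpha=(\alpha_1,\dots,\alpha_r)\vDash n$ (a tuple of positive integers with sum $n$, of length $\ell(\alpha)=r$), $C_\alpha=\prod_{k=1}^r\binom{\alpha_1+\cdots+\alpha_k-1}{\alpha_k-1}$. A restricted Rota-Baxter Lie algebra $(\mathfrak g,[-,-],(-)^{[p]},R)$ of weight $\lambda$ is a restricted Lie algebra with a Rota-Baxter operator $R$ of weight $\lambda$ such that $R(x^{[p]_R})=R(x)^{[p]}$ for all $x\in\mathfrak g$, where, with $x\rhd_Ry:=[R(x),y]$ and $x^{\rhd_Rk}:=x\rhd_R(x\rhd_R\cdots(x\rhd_Rx)\cdots)$ ($k$ copies of $x$, $x^{\rhd_R1}=x$), $$x^{[p]_R}:=\lambda^{p-1}x^{[p]}+\sum_{r=1}^{p-1}\frac1r\lambda^{r-1}\sum_{\alpha\vDash p,\ \ell(\alpha)=r}C_\alpha\,[x^{\rhd_R\alpha_1},[x^{\rhd_R\alpha_2},[\cdots[x^{\rhd_R\alpha_{r-1}},x^{\rhd_R\alpha_r}]\cdots]]]$$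 ($\frac1r$ is the inverse of $r$ modulo $p$). *)

(* Defs.v *)
From HB Require Import structures.
From mathcomp Require Import all_boot all_algebra.
From mathcomp Require Import finmap boolp classical_sets.
From mathcomp.multinomials Require Import monalg.

Set Implicit Arguments.
Unset Strict Implicit.
Unset Printing Implicit Defensive.

Import GRing.Theory.
Local Open Scope ring_scope.
Local Open Scope quotient_scope.

Section UnbundledLinear.
Variables (k : fieldType) (V W : lmodType k) (F : V -> W).
Hypothesis lF : linear F.
Let F' : {linear V -> W} := HB.pack F (GRing.isLinear.Build k V W _ F lF).

Lemma lin0 : F 0 = 0. Proof. exact: (linear0 F'). Qed.
Lemma linD u v : F (u + v) = F u + F v. Proof. exact: (linearD F'). Qed.
Lemma linB u v : F (u - v) = F u - F v. Proof. exact: (linearB F'). Qed.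
Lemma linZ a u : F (a *: u) = a *: F u. Proof. exact: (linearZ_LR F'). Qed.

End UnbundledLinear.

Lemma comp_lin (k : fieldType) (U V W : lmodType k) (F : V -> W) (G : U -> V) :
  linear F -> linear G -> linear (fun x => F (G x)).
Proof. by move=> lF lG a u v; rewrite lG lF. Qed.

Section LinearExtension.
Variables (k : fieldType) (K : choiceType) (W : lmodType k).

Definition flift (h : K -> W) (w : {malg k[K]}) : W :=
  \sum_(x <- msupp w) w@_x *: h x.

Lemma fliftEw (h : K -> W) (d : {fset K}) w :
  (msupp w `<=` d)%fset -> flift h w = \sum_(x <- d) w@_x *: h x.
Proof.
move=> le; rewrite /flift (big_fset_incl _ le) // => x _.
by move/mcoeff_outdom ->; rewrite scale0r.
Qed.

Lemma flift_linear h : linear (flift h).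
Proof.
move=> a u v.
have le1 : (msupp u `<=` msupp u `|` msupp v)%fset by apply: fsubsetUl.
have le2 : (msupp v `<=` msupp u `|` msupp v)%fset by apply: fsubsetUr.
have le3 : (msupp (a *: u + v)%R `<=` msupp u `|` msupp v)%fset.
  apply: (fsubset_trans (msuppD_le _ _)).
  by apply: fsetSU; apply: msuppZ_le.
rewrite (fliftEw _ le1) (fliftEw _ le2) (fliftEw _ le3).
rewrite scaler_sumr -big_split /=; apply: eq_bigr => x _.
by rewrite mcoeffD mcoeffZ scalerDl scalerA.
Qed.

HB.instance Definition _ h :=
  GRing.isLinear.Build k {malg k[K]} W _ (flift h) (flift_linear h).

Lemma fliftU h x : flift h << x >> = h x.
Proof.
rewrite (fliftEw _ (@msuppU_le _ _ x 1)) big_seq_fset1.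
by rewrite mcoeffUU scale1r.
Qed.

Lemma malg_ind (P : {malg k[K]} -> Prop) :
  P 0 -> (forall a x w, P w -> P (a *: << x >> + w)) -> forall w, P w.
Proof.
move=> P0 PD w; rewrite [w]monalgE.
elim: (enum_fset (msupp w)) => [|x s IH]; first by rewrite big_nil.
rewrite big_cons.
have -> : << w@_x *g x >> = w@_x *: << x >> :> {malg k[K]}.
  apply/malgP => y; rewrite mcoeffZ !mcoeffU.
  by case: (x == y); rewrite ?mulr1 ?mulr0.
exact: PD.
Qed.

End LinearExtension.

Section QuotientModule.
Variables (k : fieldType) (V : lmodType k).

Record submodule := Submodule {
  submem :> V -> Prop;
  submem0 : submem 0;
  submemZD : forall a u v, submem u -> submem v -> submem (a *: u + v) }.

Inductive span (X : V -> Prop) : V -> Prop :=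
| span_gen u of X u : span X u
| span0 : span X 0
| spanZD a u v of span X u & span X v : span X (a *: u + v).

Definition span_submodule X := Submodule (span0 X) (@spanZD X).

Variable S : submodule.

Lemma submemB u v : S u -> S v -> S (u - v).
Proof. by move=> Su Sv; rewrite addrC -scaleN1r; apply: submemZD. Qed.

Lemma submemD u v : S u -> S v -> S (u + v).
Proof. by move=> Su Sv; rewrite -[u]scale1r; apply: submemZD. Qed.

Lemma submemZ a u : S u -> S (a *: u).
Proof. by move=> Su; rewrite -[_ *: _]addr0; apply: submemZD => //; apply: submem0. Qed.

Definition qrel : rel V := fun u v => `[< S (u - v) >].

Lemma qrel_refl : reflexive qrel.
Proof. by move=> u; apply/asboolP; rewrite subrr; apply: submem0. Qed.

Lemma qrel_sym : symmetric qrel.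
Proof.
by move=> u v; apply/asboolP/asboolP => h; rewrite -opprB -scaleN1r; apply: submemZ.
Qed.

Lemma qrel_trans : transitive qrel.
Proof.
move=> v u w /asboolP h1 /asboolP h2; apply/asboolP.
by rewrite -(subrKA v u); apply: submemD.
Qed.

Canonical qrel_equiv := EquivRel qrel qrel_refl qrel_sym qrel_trans.

Definition quotm : Type := {eq_quot qrel_equiv}.
HB.instance Definition _ := Choice.on quotm.

Definition qpi (v : V) : quotm := \pi_{eq_quot qrel_equiv} v.
Definition qrep (q : quotm) : V := repr (q : {eq_quot qrel_equiv}).

Lemma qrepK q : qpi (qrep q) = q.
Proof. exact: reprK. Qed.

Lemma qpiP u v : qpi u = qpi v <-> S (u - v).
Proof.
split; first by move=> h; apply/asboolP; move/eqP: h; rewrite eqmodE.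
by move=> h; apply/eqP; rewrite eqmodE; apply/asboolP.
Qed.

Lemma qrep_pi v : S (qrep (qpi v) - v).
Proof. by apply/qpiP; rewrite qrepK. Qed.

(* The operations on quotients and tensors are locked because unification
   otherwise unfolds them down to the finitely supported functions of {malg _}. *)
Fact quotm_key : unit. Proof. by []. Qed.
Definition qzero := locked_with quotm_key (qpi 0).
Definition qopp := locked_with quotm_key (fun q => qpi (- qrep q)).
Definition qadd := locked_with quotm_key (fun q r => qpi (qrep q + qrep r)).
Definition qscale := locked_with quotm_key (fun a q => qpi (a *: qrep q)).

Lemma qpiD u v : qpi (u + v) = qadd (qpi u) (qpi v).
Proof.
rewrite /qadd locked_withE; apply/esym/qpiP; rewrite opprD addrACA.
by apply: submemD; apply: qrep_pi.
Qed.

Lemma qpiN u : qpi (- u) = qopp (qpi u).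
Proof.
by rewrite /qopp locked_withE; apply/esym/qpiP; rewrite -opprD -[- _]scaleN1r; apply: submemZ; apply: qrep_pi.
Qed.

Lemma qpiZ a u : qpi (a *: u) = qscale a (qpi u).
Proof.
by rewrite /qscale locked_withE; apply/esym/qpiP; rewrite -scalerBr; apply: submemZ; apply: qrep_pi.
Qed.

Lemma qind (P : quotm -> Prop) : (forall v, P (qpi v)) -> forall q, P q.
Proof. by move=> h q; rewrite -[q]qrepK. Qed.

Lemma qaddA : associative qadd.
Proof. by elim/qind=> x; elim/qind=> y; elim/qind=> z; rewrite -!qpiD addrA. Qed.
Lemma qaddC : commutative qadd.
Proof. by elim/qind=> x; elim/qind=> y; rewrite -!qpiD addrC. Qed.
Lemma qadd0 : left_id qzero qadd.
Proof. by elim/qind=> x; rewrite /qzero locked_withE -!qpiD add0r. Qed.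
Lemma qaddN : left_inverse qzero qopp qadd.
Proof. by elim/qind=> x; rewrite /qzero locked_withE -qpiN -!qpiD addNr. Qed.
HB.instance Definition _ := GRing.isZmodule.Build quotm qaddA qaddC qadd0 qaddN.

Lemma qpi_add u v : qpi (u + v) = qpi u + qpi v.
Proof. exact: qpiD. Qed.

Lemma qscaleA a b q : qscale a (qscale b q) = qscale (a * b) q.
Proof. by elim/qind: q => x; rewrite -!qpiZ scalerA. Qed.
Lemma qscale1 : left_id 1 qscale.
Proof. by elim/qind=> x; rewrite -!qpiZ scale1r. Qed.
Lemma qscaleDr : right_distributive qscale +%R.
Proof. by move=> a; elim/qind=> x; elim/qind=> y; rewrite -qpi_add -!qpiZ -qpi_add scalerDr. Qed.
Lemma qscaleDl q : {morph qscale^~ q : a b / a + b}.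
Proof. by elim/qind: q => x a b; rewrite -!qpiZ -!qpi_add scalerDl. Qed.
HB.instance Definition _ :=
  GRing.Zmodule_isLmodule.Build k quotm qscaleA qscale1 qscaleDr qscaleDl.

Lemma qpi_linear : linear qpi.
Proof. by move=> a u v; rewrite qpi_add qpiZ. Qed.
HB.instance Definition _ := GRing.isLinear.Build k V quotm _ qpi qpi_linear.

(* The map induced by f on the quotient; meaningful only when f is compatible
   with S. *)
Definition qlift (W : Type) (f : V -> W) (q : quotm) : W := f (qrep q).

Lemma qliftE (W : lmodType k) (f : V -> W) v : linear f ->
  (forall u, S u -> f u = 0) -> qlift f (qpi v) = f v.
Proof.
move=> lf f0; have := f0 _ (qrep_pi v).
by rewrite (linB lf) => /eqP; rewrite subr_eq0 => /eqP.
Qed.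

Lemma qlift_linear (W : lmodType k) (f : V -> W) : linear f ->
  (forall u, S u -> f u = 0) -> linear (qlift f).
Proof.
move=> lf f0 a; elim/qind=> x; elim/qind=> y.
by rewrite -qpi_linear !qliftE // lf.
Qed.

End QuotientModule.

Arguments qpi {k V} S.
Arguments qlift {k V} S {W}.

Section TensorProduct.
Variables (k : fieldType) (U V : lmodType k).

Inductive tens_rel : {malg k[(U * V)%type]} -> Prop :=
| TensL a u u' v :
    tens_rel (<< (a *: u + u', v) >> - (a *: << (u, v) >> + << (u', v) >>))
| TensR a u v v' :
    tens_rel (<< (u, a *: v + v') >> - (a *: << (u, v) >> + << (u, v') >>)).

Definition tens : Type := quotm (span_submodule tens_rel).
HB.instance Definition _ := GRing.Lmodule.on tens.

Fact tens_key : unit. Proof. by []. Qed.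
Definition tpure : U -> V -> tens := locked_with tens_key
  (fun u v => qpi (span_submodule tens_rel) << (u, v) >>).

Definition bilin (W : lmodType k) (f : U -> V -> W) :=
  (forall v, linear (f^~ v)) /\ (forall u, linear (f u)).

Lemma tpure_bilin : bilin tpure.
Proof.
split=> [v a u u'|u a v v']; rewrite /tpure locked_withE -qpi_linear.
  by apply/qpiP/span_gen/TensL.
by apply/qpiP/span_gen/TensR.
Qed.

(* The linear map on the tensor product induced by f; meaningful only when f is
   bilinear. In Sweedler notation, tlift f (comul x) is f(x_1, x_2). *)
Definition tlift (W : lmodType k) (f : U -> V -> W) : tens -> W :=
  locked_with tens_key
    (qlift (span_submodule tens_rel) (flift (fun uv => f uv.1 uv.2))).

Section Lift.
Variables (W : lmodType k) (f : U -> V -> W).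
Hypothesis bf : bilin f.

Lemma tlift_ker w : span tens_rel w -> flift (fun uv => f uv.1 uv.2) w = 0.
Proof.
elim=> [w' [a u u' v|a u v v']| |a w1 w2 _ h1 _ h2].
- by rewrite linearB linearP /= !fliftU /= bf.1 subrr.
- by rewrite linearB linearP /= !fliftU /= bf.2 subrr.
- exact: linear0.
- by rewrite linearP /= h1 h2 scaler0 addr0.
Qed.

Lemma tlift_linear : linear (tlift f).
Proof.
by rewrite /tlift locked_withE; apply: qlift_linear; [apply: flift_linear|apply: tlift_ker].
Qed.

Lemma tliftE u v : tlift f (tpure u v) = f u v.
Proof.
rewrite /tlift /tpure !locked_withE qliftE; first by rewrite fliftU.
  exact: flift_linear.
exact: tlift_ker.
Qed.

End Lift.

Lemma tens_ind (P : tens -> Prop) :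
  P 0 -> (forall u v t, P t -> P (tpure u v + t)) -> forall t, P t.
Proof.
move=> P0 PD; elim/qind; elim/malg_ind => [|a [u v] w IH]; first by rewrite linear0.
rewrite qpi_linear.
have -> : a *: qpi (span_submodule tens_rel) << (u, v) >> = tpure (a *: u) v.
  by rewrite (linZ (tpure_bilin.1 v)) /tpure locked_withE.
exact: PD.
Qed.

Lemma eq_tens (W : lmodType k) (F G : tens -> W) : linear F -> linear G ->
  (forall u v, F (tpure u v) = G (tpure u v)) -> F =1 G.
Proof.
move=> lF lG FG.
elim/tens_ind => [|u v t IH]; first by rewrite (lin0 lF) (lin0 lG).
by rewrite (linD lF) (linD lG) FG IH.
Qed.

End TensorProduct.

Arguments tens {k} (U V)%_type.
Arguments tpure {k U V}.
Notation "U ⊗ V" := (tens U V) (at level 40, left associativity) : type_scope.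
Notation "u ⊗ v" := (tpure u v) (at level 40, left associativity) : ring_scope.

Section TensorMaps.
Variable k : fieldType.

Lemma tlift_param (X U V W : lmodType k) (f : X -> U -> V -> W) t :
  (forall x, bilin (f x)) -> (forall u v, linear (fun x => f x u v)) ->
  linear (fun x => tlift (f x) t).
Proof.
move=> bf lf a x y; move: t; apply: eq_tens.
- exact: tlift_linear.
- move=> b s t; rewrite !(tlift_linear (bf _)) scalerDr addrACA !scalerA.
  by rewrite [a * b]mulrC scalerDr !scalerA.
- by move=> u v; rewrite !tliftE // lf.
Qed.

Definition tmap (U V U' V' : lmodType k) (f : U -> U') (g : V -> V') :
  U ⊗ V -> U' ⊗ V' := tlift (fun u v => f u ⊗ g v).

Lemma tmap_bilin (U V U' V' : lmodType k) (f : U -> U') (g : V -> V') :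
  linear f -> linear g -> bilin (fun u v => f u ⊗ g v).
Proof.
move=> lf lg; split=> [v a x y|u a x y]; first by rewrite lf (tpure_bilin _ _).1.
by rewrite lg (tpure_bilin _ _).2.
Qed.

Lemma tmapE (U V U' V' : lmodType k) (f : U -> U') (g : V -> V') u v :
  linear f -> linear g -> tmap f g (u ⊗ v) = f u ⊗ g v.
Proof. by move=> lf lg; rewrite /tmap tliftE //; apply: tmap_bilin. Qed.

Lemma tmap_linear (U V U' V' : lmodType k) (f : U -> U') (g : V -> V') :
  linear f -> linear g -> linear (tmap f g).
Proof. by move=> lf lg; apply/tlift_linear/tmap_bilin. Qed.

Definition tswap (U V : lmodType k) : U ⊗ V -> V ⊗ U := tlift (fun u v => v ⊗ u).

Lemma tswap_bilin (U V : lmodType k) : bilin (fun (u : U) (v : V) => v ⊗ u).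
Proof.
split=> [v a x y|u a x y]; first by rewrite (tpure_bilin _ _).2.
by rewrite (tpure_bilin _ _).1.
Qed.

Definition tassoc (U V W : lmodType k) : (U ⊗ V) ⊗ W -> U ⊗ (V ⊗ W) :=
  tlift (fun uv w => tlift (fun u v => u ⊗ (v ⊗ w)) uv).

Lemma tassoc_bilin1 (U V W : lmodType k) (w : W) :
  bilin (fun (u : U) (v : V) => u ⊗ (v ⊗ w)).
Proof.
split=> [v a x y|u a x y]; first by rewrite (tpure_bilin _ _).1.
by rewrite (tpure_bilin _ _).1 (tpure_bilin _ _).2.
Qed.

Lemma tassoc_bilin2 (U V W : lmodType k) :
  bilin (fun (t : U ⊗ V) (w : W) => tlift (fun u v => u ⊗ (v ⊗ w)) t).
Proof.
split=> [w|t]; first exact/tlift_linear/tassoc_bilin1.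
apply: (@tlift_param W U V _ (fun w u v => u ⊗ (v ⊗ w))) => [w|u v a x y].
  exact: tassoc_bilin1.
by rewrite !(tpure_bilin _ _).2.
Qed.

Lemma tassoc_linear (U V W : lmodType k) : linear (@tassoc U V W).
Proof. exact/tlift_linear/tassoc_bilin2. Qed.

Lemma tassocE (U V W : lmodType k) (u : U) (v : V) (w : W) :
  tassoc (u ⊗ v ⊗ w) = u ⊗ (v ⊗ w).
Proof.
rewrite /tassoc tliftE ?tliftE //; first exact: tassoc_bilin1.
exact: tassoc_bilin2.
Qed.

End TensorMaps.

Lemma linear_functional (k : fieldType) (V : lmodType k) (v : V) : v != 0 ->
  exists f : V -> k^o, linear f /\ f v = 1.
Proof.
move=> v0.
pose P (A : set V) :=
  (forall a x y, A x -> A y -> A (a *: x + y)) /\ ~ A v.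
have [F FP totF|A [[AP Av] Amax]] := @Zorn_bigcup V P.
  split=> [a x y [X FX Xx] [Y FY Yy]|[X /FP [_ Xv] /Xv //]].
  have [XY|YX] := totF _ _ FX FY.
    by exists Y => //; apply: (FP _ FY).1 => //; apply: XY.
  by exists X => //; apply: (FP _ FX).1 => //; apply: YX.
have A0 : A 0.
  apply: contrapT => nA0.
  have nA x : ~ A x.
    by move=> Ax; apply: nA0; rewrite -(addNr x) -scaleN1r; apply: AP.
  apply: (Amax [set 0]%classic); last first.
    split=> [a x y /= -> ->|/= ve]; first by rewrite scaler0 addr0.
    by rewrite ve eqxx in v0.
  by split=> [x /nA //|/(_ 0 erefl)].
have AZ a x : A x -> A (a *: x).
  by move=> Ax; rewrite -[_ *: x]addr0; apply: AP.
have AD x y : A x -> A y -> A (x + y).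
  by move=> Ax Ay; rewrite -[x]scale1r; apply: AP.
have dec x : exists c, A (x - c *: v).
  have [Ax|nAx] := pselect (A x); first by exists 0; rewrite scale0r subr0.
  pose B : set V := fun y => exists c, A (y - c *: x).
  have AB : (A `<` B)%classic.
    split=> [y Ay|BA]; first by exists 0; rewrite scale0r subr0.
    by apply: nAx; apply: BA; exists 1; rewrite scale1r subrr.
  have : ~ P B by apply: Amax.
  have BP a y z : B y -> B z -> B (a *: y + z).
    move=> [c Ac] [d Ad]; exists (a * c + d).
    have -> : a *: y + z - (a * c + d) *: x =
        a *: (y - c *: x) + (z - d *: x).
      by rewrite scalerBr scalerA scalerDl opprD addrACA.
    exact: AP.
  move=> nPB; have [c Ac] : B v by apply: contrapT => nBv; apply: nPB.
  have c0 : c != 0.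
    by apply/eqP => c0; apply: Av; rewrite c0 scale0r subr0 in Ac.
  exists c^-1; have -> : x - c^-1 *: v = (- c^-1) *: (v - c *: x).
    by rewrite scaleNr scalerBr scalerA mulVf // scale1r opprB.
  exact: AZ.
have [f fP] := boolp.choice dec.
have uniqc c d x : A (x - c *: v) -> A (x - d *: v) -> c = d.
  move=> Ac Ad; apply/eqP; rewrite -subr_eq0; apply/negPn/negP => cd.
  apply: Av; have -> : v = (c - d)^-1 *: ((-1) *: (x - c *: v) + (x - d *: v)).
    rewrite scaleN1r opprB subrKA.
    by rewrite -scalerBl scalerA mulVf // scale1r.
  by apply: AZ; apply: AP.
exists f; split=> [a x y|]; last first.
  by apply: (uniqc _ _ v) => //; rewrite scale1r subrr.
apply: (uniqc _ _ (a *: x + y)) => //.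
have -> : a *: x + y - (a * f x + f y) *: v =
    a *: (x - f x *: v) + (y - f y *: v).
  by rewrite scalerBr scalerA scalerDl opprD addrACA.
exact: AP.
Qed.

Section TensorAlgebra.
Variables (k : fieldType) (A B : algType k).

Definition tmul (s t : A ⊗ B) : A ⊗ B :=
  tlift (fun a b => tlift (fun c d => (a * c) ⊗ (b * d)) t) s.

Lemma tmul_bilin1 (a : A) (b : B) : bilin (fun c d => (a * c) ⊗ (b * d)).
Proof. by apply: tmap_bilin => x y z; rewrite mulrDr scalerAr. Qed.

Lemma tmul_bilin2 (t : A ⊗ B) :
  bilin (fun a b => tlift (fun c d => (a * c) ⊗ (b * d)) t).
Proof.
split=> [b|a].
  apply: (@tlift_param _ A A B _ (fun a c d => (a * c) ⊗ (b * d))).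
    by move=> a; apply: tmul_bilin1.
  by move=> c d x y z; rewrite mulrDl -scalerAl (tpure_bilin _ _).1.
apply: (@tlift_param _ B A B _ (fun b c d => (a * c) ⊗ (b * d))).
  by move=> b; apply: tmul_bilin1.
by move=> c d x y z; rewrite mulrDl -scalerAl (tpure_bilin _ _).2.
Qed.

Lemma tmul_purel a b t :
  tmul (a ⊗ b) t = tlift (fun c d => (a * c) ⊗ (b * d)) t.
Proof. exact: (tliftE (tmul_bilin2 t)). Qed.

Lemma tmulE a b c d : tmul (a ⊗ b) (c ⊗ d) = (a * c) ⊗ (b * d).
Proof. by rewrite tmul_purel (tliftE (tmul_bilin1 _ _)). Qed.

Lemma tmul_linl t : linear (tmul^~ t).
Proof. exact/tlift_linear/tmul_bilin2. Qed.

Lemma tmul_linr s : linear (tmul s).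
Proof.
move=> a t t'; move: s; apply: eq_tens.
- exact: tmul_linl.
- move=> b s s'; rewrite !tmul_linl scalerDr addrACA !scalerA.
  by rewrite [a * b]mulrC scalerDr !scalerA.
- by move=> u v; rewrite !tmul_purel (tlift_linear (tmul_bilin1 _ _)).
Qed.

Lemma tmulDl : left_distributive tmul +%R.
Proof. by move=> x y z; rewrite (linD (tmul_linl _)). Qed.

Lemma tmulDr : right_distributive tmul +%R.
Proof. by move=> x y z; rewrite (linD (tmul_linr _)). Qed.

Lemma tmulA : associative tmul.
Proof.
move=> x y z; elim/tens_ind: x => [|a b x IH].
  by rewrite !(lin0 (tmul_linl _)).
rewrite !tmulDl IH; congr (_ + _) => {x IH}.
elim/tens_ind: y => [|c d y IH].
  by rewrite !(lin0 (tmul_linl _), lin0 (tmul_linr _)).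
rewrite !(tmulDl, tmulDr) IH; congr (_ + _) => {y IH}.
elim/tens_ind: z => [|e f z IH]; first by rewrite !(lin0 (tmul_linr _)).
by rewrite !tmulDr IH !tmulE !mulrA.
Qed.

Lemma tmul1 : left_id (1 ⊗ 1) tmul.
Proof.
move=> x; elim/tens_ind: x => [|a b x IH]; first by rewrite (lin0 (tmul_linr _)).
by rewrite tmulDr IH tmulE !mul1r.
Qed.

Lemma tmulr1 : right_id (1 ⊗ 1) tmul.
Proof.
move=> x; elim/tens_ind: x => [|a b x IH]; first by rewrite (lin0 (tmul_linl _)).
by rewrite tmulDl IH tmulE !mulr1.
Qed.

Lemma tens1_neq0 : (1 ⊗ 1 : A ⊗ B) != 0.
Proof.
have [f [lf f1]] := linear_functional (oner_neq0 A).
have [g [lg g1]] := linear_functional (oner_neq0 B).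
have bfg : bilin (fun a b => f a * g b : k^o).
  split=> [b c x y|a c x y]; first by rewrite lf mulrDl -scalerAl.
  by rewrite lg mulrDr -scalerAr.
apply/eqP => /(congr1 (tlift (fun a b => f a * g b : k^o))).
rewrite (lin0 (tlift_linear bfg)) (tliftE bfg) f1 g1 mulr1.
by move/eqP; rewrite oner_eq0.
Qed.

HB.instance Definition _ := GRing.Zmodule_isNzRing.Build (tens A B)
  tmulA tmul1 tmulr1 tmulDl tmulDr tens1_neq0.

Lemma tscalerAl (a : k) (s t : A ⊗ B) : a *: (s * t) = a *: s * t.
Proof. by rewrite -[RHS]/(tmul _ _) (linZ (tmul_linl _)). Qed.

HB.instance Definition _ := GRing.Lmodule_isLalgebra.Build k (tens A B) tscalerAl.

Lemma tscalerAr (a : k) (s t : A ⊗ B) : a *: (s * t) = s * (a *: t).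
Proof. by rewrite -[RHS]/(tmul _ _) (linZ (tmul_linr _)). Qed.

HB.instance Definition _ := GRing.Lalgebra_isAlgebra.Build k (tens A B) tscalerAr.

Lemma tpureM (a c : A) (b d : B) : (a ⊗ b) * (c ⊗ d) = (a * c) ⊗ (b * d).
Proof. exact: tmulE. Qed.

Lemma tpure1 : 1 ⊗ 1 = 1 :> A ⊗ B.
Proof. by []. Qed.

End TensorAlgebra.

Section QuotientAlgebra.
Variables (k : fieldType) (A : algType k).

Record ideal := Ideal {
  ideal_sub :> submodule A;
  idealMl : forall a x, ideal_sub x -> ideal_sub (a * x);
  idealMr : forall a x, ideal_sub x -> ideal_sub (x * a);
  ideal_proper : ~ ideal_sub 1 }.

Inductive ideal_gen (X : A -> Prop) : A -> Prop :=
| ideal_gen_gen x of X x : ideal_gen X x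
| ideal_gen0 : ideal_gen X 0
| ideal_genZD a x y of ideal_gen X x & ideal_gen X y : ideal_gen X (a *: x + y)
| ideal_genMl a x of ideal_gen X x : ideal_gen X (a * x)
| ideal_genMr a x of ideal_gen X x : ideal_gen X (x * a).

Definition ideal_gen_submodule X :=
  Submodule (ideal_gen0 X) (@ideal_genZD X).

Variable I : ideal.

Definition quota : Type := quotm I.
HB.instance Definition _ := GRing.Lmodule.on quota.

Definition qone : quota := locked_with quotm_key (qpi I 1).
Definition qmul : quota -> quota -> quota :=
  locked_with quotm_key (fun q r => qpi I (qrep q * qrep r)).
Definition qproj : A -> quota := locked_with quotm_key (qpi I).

Lemma qprojE : qproj = qpi I. Proof. exact: locked_withE. Qed.

Lemma qpiM x y : qpi I (x * y) = qmul (qpi I x) (qpi I y).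
Proof.
rewrite /qmul locked_withE; apply/esym/qpiP; set x' := qrep _; set y' := qrep _.
have -> : x' * y' - x * y = (x' - x) * y' + x * (y' - y).
  by rewrite mulrBl mulrBr subrKA.
apply: submemD; first exact/idealMr/qrep_pi.
exact/idealMl/qrep_pi.
Qed.

Lemma qmulA : associative qmul.
Proof. by elim/qind=> x; elim/qind=> y; elim/qind=> z; rewrite -!qpiM mulrA. Qed.
Lemma qmul1 : left_id qone qmul.
Proof. by elim/qind=> x; rewrite /qone locked_withE -!qpiM mul1r. Qed.
Lemma qmulr1 : right_id qone qmul.
Proof. by elim/qind=> x; rewrite /qone locked_withE -!qpiM mulr1. Qed.
Lemma qmulDl : left_distributive qmul +%R.
Proof.
by elim/qind=> x; elim/qind=> y; elim/qind=> z; rewrite -qpi_add -!qpiM -qpi_add mulrDl.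
Qed.
Lemma qmulDr : right_distributive qmul +%R.
Proof.
by elim/qind=> x; elim/qind=> y; elim/qind=> z; rewrite -qpi_add -!qpiM -qpi_add mulrDr.
Qed.
Lemma qone_neq0 : qone != 0.
Proof.
rewrite /qone locked_withE -[0](linear0 (qpi I)).
by apply/eqP => /qpiP; rewrite subr0; apply: ideal_proper.
Qed.

HB.instance Definition _ := GRing.Zmodule_isNzRing.Build quota
  qmulA qmul1 qmulr1 qmulDl qmulDr qone_neq0.

Lemma qproj_linear : linear qproj.
Proof. rewrite qprojE; exact: qpi_linear. Qed.
HB.instance Definition _ := GRing.isLinear.Build k A quota _ qproj qproj_linear.

Lemma qproj_multiplicative : monoid_morphism qproj.
Proof.
rewrite qprojE; split=> [|x y].
  exact: (esym (locked_withE quotm_key (qpi I 1))).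
exact: qpiM.
Qed.
HB.instance Definition _ := GRing.isMonoidMorphism.Build A quota qproj
  qproj_multiplicative.

Lemma qproj_ind (P : quota -> Prop) : (forall v, P (qproj v)) -> forall q, P q.
Proof. rewrite qprojE; exact: qind. Qed.

Lemma qscalerAl (a : k) (s t : quota) : a *: (s * t) = a *: s * t.
Proof.
elim/qproj_ind: s => s; elim/qproj_ind: t => t.
by rewrite -rmorphM -!linearZ_LR -rmorphM scalerAl.
Qed.
HB.instance Definition _ := GRing.Lmodule_isLalgebra.Build k quota qscalerAl.

Lemma qscalerAr (a : k) (s t : quota) : a *: (s * t) = s * (a *: t).
Proof.
elim/qproj_ind: s => s; elim/qproj_ind: t => t.
by rewrite -rmorphM -!linearZ_LR -rmorphM scalerAr.
Qed.
HB.instance Definition _ := GRing.Lalgebra_isAlgebra.Build k quota qscalerAr.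

End QuotientAlgebra.

Arguments quota {k A} I.
Arguments qproj {k A} I.

Section AlgebraMorphisms.
Variable k : fieldType.

Record alg_morph (A B : algType k) (F : A -> B) : Prop := AlgMorph {
  am_lin : linear F;
  am1 : F 1 = 1;
  amM : {morph F : x y / x * y} }.

Lemma am_comp (A B C : algType k) (F : B -> C) (G : A -> B) :
  alg_morph F -> alg_morph G -> alg_morph (fun x => F (G x)).
Proof.
move=> [lF F1 FM] [lG G1 GM]; split; first exact: comp_lin.
- by rewrite G1.
- by move=> x y; rewrite GM FM.
Qed.

Lemma amX (A B : algType k) (F : A -> B) x n :
  alg_morph F -> F (x ^+ n) = F x ^+ n.
Proof.
by move=> [lF F1 FM]; elim: n => [|n IH]; rewrite ?expr0 // !exprS FM IH.
Qed.

Lemma id_lin (V : lmodType k) : linear (@id V).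
Proof. by []. Qed.

Lemma am_id (A : algType k) : alg_morph (@id A).
Proof. by split. Qed.

Lemma qproj_am (A : algType k) (I : ideal A) : alg_morph (qproj I).
Proof.
split; first exact: qproj_linear.
  exact: (qproj_multiplicative I).1.
exact: (qproj_multiplicative I).2.
Qed.

Lemma tens_am (A B C : algType k) (F : A ⊗ B -> C) : linear F ->
  F (1 ⊗ 1) = 1 ->
  (forall a b c d, F ((a * c) ⊗ (b * d)) = F (a ⊗ b) * F (c ⊗ d)) ->
  alg_morph F.
Proof.
move=> lF F1 FM; split=> // s t.
elim/tens_ind: s => [|a b s IH]; first by rewrite mul0r (lin0 lF) mul0r.
rewrite mulrDl !(linD lF) mulrDl IH; congr (_ + _) => {s IH}.
elim/tens_ind: t => [|c d t IH]; first by rewrite mulr0 (lin0 lF) mulr0.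
by rewrite mulrDr !(linD lF) mulrDr IH tpureM FM.
Qed.

Lemma tmap_am (A B A' B' : algType k) (f : A -> A') (g : B -> B') :
  alg_morph f -> alg_morph g -> alg_morph (tmap f g).
Proof.
move=> [lf f1 fM] [lg g1 gM]; apply: tens_am; first exact: tmap_linear.
  by rewrite tmapE // f1 g1.
by move=> a b c d; rewrite !tmapE // fM gM tpureM.
Qed.

Lemma tmap_comp (U V U' V' U'' V'' : lmodType k) (f' : U' -> U'')
  (g' : V' -> V'') (f : U -> U') (g : V -> V') :
  linear f' -> linear g' -> linear f -> linear g ->
  forall t, tmap f' g' (tmap f g t) = tmap (fun x => f' (f x)) (fun x => g' (g x)) t.
Proof.
move=> lf' lg' lf lg; apply: eq_tens.
- by apply: comp_lin; apply: tmap_linear.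
- by apply: tmap_linear; apply: comp_lin.
- by move=> u v; rewrite !tmapE //; apply: comp_lin.
Qed.

Lemma tassoc_am (A B C : algType k) : alg_morph (@tassoc k A B C).
Proof.
apply: tens_am; first exact: tassoc_linear.
  by rewrite -tpure1 tassocE.
move=> s c t d.
have tl := @tassoc_linear k A B C.
have pl (x : C) : linear (fun s : A ⊗ B => s ⊗ x) by exact: (tpure_bilin _ _).1.
elim/tens_ind: s => [|a b s IH].
  by rewrite mul0r !(lin0 (pl _)) !(lin0 tl) mul0r.
rewrite mulrDl !(linD (pl _)) !(linD tl) mulrDl IH; congr (_ + _) => {s IH}.
elim/tens_ind: t => [|a' b' t IH].
  by rewrite mulr0 !(lin0 (pl _)) !(lin0 tl) mulr0.
rewrite mulrDr !(linD (pl _)) !(linD tl) mulrDr IH; congr (_ + _).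
by rewrite tpureM !tassocE !tpureM.
Qed.

Lemma tswap_am (A B : algType k) : alg_morph (@tswap k A B).
Proof.
have bs := @tswap_bilin k A B.
apply: tens_am; first exact: tlift_linear.
  by rewrite /tswap (tliftE bs).
by move=> a b c d; rewrite /tswap !(tliftE bs) tpureM.
Qed.

Lemma ideal_gen_ker (A B : algType k) (F : A -> B) (X : A -> Prop) :
  alg_morph F -> (forall x, X x -> F x = 0) ->
  forall x, ideal_gen X x -> F x = 0.
Proof.
move=> [lF F1 FM] FX x; elim=> {x} [x /FX //||a x y _ h _ h'|a x _ h|a x _ h].
- exact: lin0.
- by rewrite lF h h' scaler0 addr0.
- by rewrite FM h mulr0.
- by rewrite FM h mul0r.
Qed.

Lemma ideal_gen_proper (A : algType k) (F : A -> k^o) (X : A -> Prop) :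
  alg_morph F -> (forall x, X x -> F x = 0) -> ~ ideal_gen X 1.
Proof.
move=> aF FX /(ideal_gen_ker aF FX); rewrite (am1 aF) => /eqP.
by rewrite oner_eq0.
Qed.

Definition gen_ideal (A : algType k) (X : A -> Prop) (pX : ~ ideal_gen X 1) :
  ideal A :=
  @Ideal k A (ideal_gen_submodule X) (@ideal_genMl k A X) (@ideal_genMr k A X) pX.

Lemma qlift_proj (A : algType k) (I : ideal A) (W : lmodType k) (f : A -> W) x :
  linear f -> (forall x, I x -> f x = 0) -> qlift I f (qproj I x) = f x.
Proof. by move=> lf f0; rewrite qprojE qliftE. Qed.

Lemma qlift_am (A B : algType k) (I : ideal A) (f : A -> B) :
  alg_morph f -> (forall x, I x -> f x = 0) ->
  alg_morph (qlift I f : quota I -> B).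
Proof.
move=> [lf f1 fM] f0; have [pl p1 pM] := qproj_am I; split.
- exact: qlift_linear.
- by rewrite -p1 qlift_proj.
- elim/qproj_ind=> x; elim/qproj_ind=> y.
  by rewrite -pM !qlift_proj // fM.
Qed.

End AlgebraMorphisms.

Section OppositeAlgebra.
Variables (k : fieldType) (A : algType k).

Definition oppalg : Type := GRing.converse A.
HB.instance Definition _ := GRing.NzRing.on oppalg.

Let opscale (a : k) (u : oppalg) : oppalg := a *: (u : A).
Let opscaleA a b u : opscale a (opscale b u) = opscale (a * b) u.
Proof. exact: (@scalerA k A). Qed.
Let opscale1 : left_id 1 opscale.
Proof. exact: (@scale1r k A). Qed.
Let opscaleDr : right_distributive opscale +%R.
Proof. exact: (@scalerDr k A). Qed.
Let opscaleDl u : {morph opscale^~ u : a b / a + b}.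
Proof. exact: (@scalerDl k A u). Qed.
HB.instance Definition _ :=
  GRing.Zmodule_isLmodule.Build k oppalg opscaleA opscale1 opscaleDr opscaleDl.

Lemma oppalg_scalerAl (a : k) (u v : oppalg) : a *: (u * v) = a *: u * v.
Proof. exact: (@scalerAr k A a v u). Qed.
HB.instance Definition _ :=
  GRing.Lmodule_isLalgebra.Build k oppalg oppalg_scalerAl.

Lemma oppalg_scalerAr (a : k) (u v : oppalg) : a *: (u * v) = u * (a *: v).
Proof. exact: (@scalerAl k A a v u). Qed.
HB.instance Definition _ :=
  GRing.Lalgebra_isAlgebra.Build k oppalg oppalg_scalerAr.

End OppositeAlgebra.

Section FreeAlgebra.
Variables (k : fieldType) (X : choiceType).

Definition freealg : Type := {malg k[{fmonom X}]}.
HB.instance Definition _ := GRing.Lalgebra.on freealg.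

Lemma malgUM (m n : {fmonom X}) :
  << m >> * << n >> = << mmul m n >> :> {malg k[{fmonom X}]}.
Proof. by rewrite malgM_def fgmulUU mulr1. Qed.

Lemma malgUMZ (m n : {fmonom X}) (a : k) :
  << m >> * (a *: << n >>) = a *: (<< m >> * << n >>) :> {malg k[{fmonom X}]}.
Proof.
have e (b : k) (q : {fmonom X}) : b *: << q >> = << b *g q >> :> {malg k[_]}.
  by apply/malgP => y; rewrite mcoeffZ !mcoeffU; case: (q == y); rewrite ?mulr1 ?mulr0.
by rewrite malgUM !e malgM_def fgmulUU mul1r.
Qed.

Lemma lalg_stepl (A : lalgType k) (a b : k) (w u v : A) :
  a *: (w * v) = w * (a *: v) -> a *: (u * v) = u * (a *: v) ->
  a *: ((b *: w + u) * v) = (b *: w + u) * (a *: v).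
Proof.
by move=> h h'; rewrite !mulrDl scalerDr h' -!scalerAl -h !scalerA mulrC.
Qed.

Lemma lalg_stepr (A : lalgType k) (a b : k) (w u v : A) :
  (forall c, w * (c *: v) = c *: (w * v)) -> a *: (w * u) = w * (a *: u) ->
  a *: (w * (b *: v + u)) = w * (a *: (b *: v + u)).
Proof.
by move=> h h'; rewrite scalerDr !mulrDr scalerDr h' scalerA !h scalerA.
Qed.

Lemma freealg_scalerAr (a : k) (u v : freealg) : a *: (u * v) = u * (a *: v).
Proof.
elim/malg_ind: u => [|b m u IH]; first by rewrite mul0r mul0r scaler0.
apply: (lalg_stepl _ _ IH) => {u IH}.
elim/malg_ind: v => [|c n v IH]; first by rewrite scaler0 mulr0 scaler0.
by apply: (lalg_stepr _ _ IH) => d; apply: malgUMZ.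
Qed.
HB.instance Definition _ :=
  GRing.Lalgebra_isAlgebra.Build k freealg freealg_scalerAr.

Definition fgen (x : X) : freealg := << fmu x >>.

Definition freelift (B : algType k) (f : X -> B) : freealg -> B :=
  flift (fun m : {fmonom X} => \prod_(x <- m) f x).

Lemma freealg_ind (P : freealg -> Prop) :
  (forall a u v, P u -> P v -> P (a *: u + v)) -> P 1 ->
  (forall x u, P u -> P (fgen x * u)) -> forall u, P u.
Proof.
move=> PD P1 PM.
have P0 : P 0 by rewrite -(addNr 1) -scaleN1r; apply: PD.
elim/malg_ind => // a m w Pw; apply: PD => // {w Pw}.
case: m => s; elim: s => [|x s IH].
  by have -> : FMonom [::] = mone :> {fmonom X} by apply/esym/fmoneE.
have -> : << FMonom (x :: s) >> = fgen x * << FMonom s >> :> freealg.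
  rewrite /fgen [RHS]malgUM; congr (mkmalgU _ _).
  by apply/esym; rewrite /mmul /= fmmulE fmuE.
exact: PM.
Qed.

Lemma alg_stepl (A B : algType k) (F : A -> B) a (w u v : A) : linear F ->
  F (w * v) = F w * F v -> F (u * v) = F u * F v ->
  F ((a *: w + u) * v) = F (a *: w + u) * F v.
Proof.
by move=> lF h h'; rewrite mulrDl -scalerAl !lF h h' mulrDl scalerAl.
Qed.

Lemma alg_stepr (A B : algType k) (F : A -> B) a (w u v : A) : linear F ->
  F (v * w) = F v * F w -> F (v * u) = F v * F u ->
  F (v * (a *: w + u)) = F v * F (a *: w + u).
Proof.
by move=> lF h h'; rewrite mulrDr -scalerAr !lF h h' mulrDr scalerAr.
Qed.

Lemma freelift_am (B : algType k) (f : X -> B) : alg_morph (freelift f).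
Proof.
have lf : linear (freelift f) by exact: flift_linear.
have f1 : freelift f 1 = 1.
  by rewrite [LHS]fliftU fm1 big_nil.
split=> // u v.
elim/malg_ind: u => [|a m u IH]; first by rewrite mul0r (lin0 lf) mul0r.
apply: (alg_stepl _ lf _ IH) => {u IH}.
elim/malg_ind: v => [|c n v IH]; first by rewrite mulr0 (lin0 lf) mulr0.
apply: (alg_stepr _ lf _ IH).
by rewrite [X in freelift f X](malgUM m n) /freelift !fliftU fmM big_cat.
Qed.

Lemma freelift_gen (B : algType k) (f : X -> B) x : freelift f (fgen x) = f x.
Proof. by rewrite /freelift /fgen fliftU fmU big_seq1. Qed.

End FreeAlgebra.

Arguments fgen k {X}.

Record cocommHopf (k : fieldType) := CocommHopf {
  hopf_alg :> algType k;
  comul : hopf_alg -> hopf_alg ⊗ hopf_alg;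
  counit : hopf_alg -> k^o;
  antipode : hopf_alg -> hopf_alg;
  comul_am : alg_morph comul;
  counit_am : alg_morph counit;
  antipode_lin : linear antipode;
  comulA : forall x,
    tassoc (tmap comul id (comul x)) = tmap id comul (comul x);
  counitl : forall x, tlift (fun a b => (counit a : k) *: b) (comul x) = x;
  counitr : forall x, tlift (fun a b => (counit b : k) *: a) (comul x) = x;
  antipodel : forall x,
    tlift (fun a b => antipode a * b) (comul x) = (counit x : k) *: 1;
  antipoder : forall x,
    tlift (fun a b => a * antipode b) (comul x) = (counit x : k) *: 1;
  comulC : forall x, tswap (comul x) = comul x }.

Arguments comul {k} c.
Arguments counit {k} c.
Arguments antipode {k} c.

Lemma tpurel_lin (k : fieldType) (T U V : lmodType k) (f : T -> U) (v : V) :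
  linear f -> linear (fun t => f t ⊗ v).
Proof. by move=> lf a x y; rewrite lf (tpure_bilin _ _).1. Qed.

Section HopfQuotient.
Variables (k : fieldType) (H : cocommHopf k) (I : ideal H).
Hypothesis I_comul :
  forall x, I x -> tmap (qproj I) (qproj I) (comul H x) = 0.
Hypothesis I_counit : forall x, I x -> counit H x = 0.
Hypothesis I_antipode : forall x, I x -> qproj I (antipode H x) = 0.

Let Q : algType k := quota I.
Let pj : H -> Q := qproj I.

Definition qcomul : Q -> Q ⊗ Q :=
  qlift I (fun x => tmap (qproj I) (qproj I) (comul H x)).
Definition qcounit : Q -> k^o := qlift I (counit H).
Definition qantipode : Q -> Q := qlift I (fun x => qproj I (antipode H x)).

Let pl : linear pj := am_lin (qproj_am I).
Let cl := am_lin (comul_am H).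
Let el := am_lin (counit_am H).
Let sl := @antipode_lin k H.

Let pcl : linear (fun x => tmap pj pj (comul H x)).
Proof. by apply: comp_lin cl; apply: tmap_linear. Qed.

Let psl : linear (fun x => pj (antipode H x)).
Proof. exact: comp_lin. Qed.

Lemma qcomulE x : qcomul (pj x) = tmap pj pj (comul H x).
Proof. exact: qlift_proj. Qed.
Lemma qcounitE x : qcounit (pj x) = counit H x.
Proof. exact: qlift_proj. Qed.
Lemma qantipodeE x : qantipode (pj x) = pj (antipode H x).
Proof. exact: (qlift_proj x psl). Qed.

Lemma qcomul_am : alg_morph qcomul.
Proof.
by apply: qlift_am => //; apply: am_comp (comul_am H); apply: tmap_am; apply: qproj_am.
Qed.
Lemma qcounit_am : alg_morph qcounit.
Proof. exact: qlift_am (counit_am H) I_counit. Qed.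
Lemma qantipode_lin : linear qantipode.
Proof. exact: qlift_linear. Qed.

Let qcl := am_lin qcomul_am.
Let qel := am_lin qcounit_am.

Lemma qcomulA x : tassoc (tmap qcomul id (qcomul x)) = tmap id qcomul (qcomul x).
Proof.
elim/qproj_ind: x => x; rewrite !qcomulE.
rewrite tmap_comp // tmap_comp //.
have -> : (fun x => qcomul (pj x)) = (fun x => tmap pj pj (comul H x)).
  by apply/funext => y; rewrite qcomulE.
transitivity (tmap pj (tmap pj pj) (tassoc (tmap (comul H) id (comul H x)))).
  move: (comul H x); apply: eq_tens.
  - by apply: comp_lin; [apply: tassoc_linear|apply: tmap_linear].
  - apply: comp_lin; first by apply: tmap_linear => //; apply: tmap_linear.
    by apply: comp_lin; [apply: tassoc_linear|apply: tmap_linear].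
  move=> u v; rewrite !tmapE //.
  move: (comul H u); apply: eq_tens.
  - apply: comp_lin; first exact: tassoc_linear.
    by apply: tpurel_lin; apply: tmap_linear.
  - apply: comp_lin; first by apply: tmap_linear => //; apply: tmap_linear.
    apply: comp_lin; first exact: tassoc_linear.
    exact: (tpurel_lin _ (@id_lin _ _)).
  have pl2 : linear (tmap pj pj) by apply: tmap_linear.
  by move=> a b; rewrite tmapE // !tassocE !tmapE.
by rewrite comulA tmap_comp //; apply: tmap_linear.
Qed.

Lemma qcounitl x : tlift (fun a b => (qcounit a : k) *: b) (qcomul x) = x.
Proof.
have bl (A : algType k) (e : A -> k^o) : linear e ->
    bilin (fun a b : A => (e a : k) *: b).
  move=> le; split=> [b a u v|a c u v].
    by rewrite le scalerDl -scalerA.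
  by rewrite scalerDr !scalerA mulrC.
elim/qproj_ind: x => x; rewrite qcomulE -[in RHS](counitl x).
move: (comul H x); apply: eq_tens.
- apply: comp_lin; last exact: tmap_linear.
  exact/tlift_linear/bl.
- by apply: comp_lin => //; apply/tlift_linear/bl.
- move=> u v; rewrite tmapE // (tliftE (bl _ _ qel)) (tliftE (bl _ _ el)).
  by rewrite qcounitE -(linZ pl).
Qed.

Lemma qcounitr x : tlift (fun a b => (qcounit b : k) *: a) (qcomul x) = x.
Proof.
have bl (A : algType k) (e : A -> k^o) : linear e ->
    bilin (fun a b : A => (e b : k) *: a).
  move=> le; split=> [b c u v|a c u v].
    by rewrite scalerDr !scalerA mulrC.
  by rewrite le scalerDl -scalerA.
elim/qproj_ind: x => x; rewrite qcomulE -[in RHS](counitr x).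
move: (comul H x); apply: eq_tens.
- apply: comp_lin; last exact: tmap_linear.
  exact/tlift_linear/bl.
- by apply: comp_lin => //; apply/tlift_linear/bl.
- move=> u v; rewrite tmapE // (tliftE (bl _ _ qel)) (tliftE (bl _ _ el)).
  by rewrite qcounitE -(linZ pl).
Qed.

Let bSl (A : algType k) (S : A -> A) : linear S ->
  bilin (fun a b : A => S a * b).
Proof.
move=> lS; split=> [b a u v|a c u v].
  by rewrite lS mulrDl scalerAl.
by rewrite mulrDr scalerAr.
Qed.

Let bSr (A : algType k) (S : A -> A) : linear S ->
  bilin (fun a b : A => a * S b).
Proof.
move=> lS; split=> [b a u v|a c u v].
  by rewrite mulrDl scalerAl.
by rewrite lS mulrDr scalerAr.
Qed.

Lemma qantipodel x :
  tlift (fun a b => qantipode a * b) (qcomul x) = (qcounit x : k) *: 1.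
Proof.
elim/qproj_ind: x => x; rewrite qcomulE qcounitE -(am1 (qproj_am I)) -(linZ pl).
rewrite -antipodel.
move: (comul H x); apply: eq_tens.
- apply: comp_lin; last exact: tmap_linear.
  exact/tlift_linear/bSl/qantipode_lin.
- by apply: comp_lin => //; apply/tlift_linear/bSl.
- move=> u v; rewrite tmapE // (tliftE (bSl qantipode_lin)) (tliftE (bSl sl)).
  by rewrite qantipodeE -(amM (qproj_am I)).
Qed.

Lemma qantipoder x :
  tlift (fun a b => a * qantipode b) (qcomul x) = (qcounit x : k) *: 1.
Proof.
elim/qproj_ind: x => x; rewrite qcomulE qcounitE -(am1 (qproj_am I)) -(linZ pl).
rewrite -antipoder.
move: (comul H x); apply: eq_tens.
- apply: comp_lin; last exact: tmap_linear.
  exact/tlift_linear/bSr/qantipode_lin.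
- by apply: comp_lin => //; apply/tlift_linear/bSr.
- move=> u v; rewrite tmapE // (tliftE (bSr qantipode_lin)) (tliftE (bSr sl)).
  by rewrite qantipodeE -(amM (qproj_am I)).
Qed.

Lemma qcomulC x : tswap (qcomul x) = qcomul x.
Proof.
elim/qproj_ind: x => x; rewrite qcomulE -[in RHS]comulC.
move: (comul H x); apply: eq_tens.
- by apply: comp_lin; [exact/tlift_linear/tswap_bilin|apply: tmap_linear].
- by apply: comp_lin; [apply: tmap_linear|exact/tlift_linear/tswap_bilin].
- move=> u v; rewrite tmapE // /tswap !(tliftE (@tswap_bilin _ _ _)).
  by rewrite tmapE.
Qed.

Definition hopf_quot : cocommHopf k :=
  CocommHopf qcomul_am qcounit_am qantipode_lin qcomulA qcounitl qcounitr
    qantipodel qantipoder qcomulC.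

End HopfQuotient.

HB.mixin Record Lmodule_isLieAlgebra (k : fieldType) L of GRing.Lmodule k L := {
  lie : L -> L -> L;
  lie_linl : forall y, linear (lie^~ y);
  lie_linr : forall x, linear (lie x);
  liexx : forall x, lie x x = 0;
  lie_jacobi : forall x y z,
    lie x (lie y z) + lie y (lie z x) + lie z (lie x y) = 0 }.

#[short(type="lieAlgType")]
HB.structure Definition LieAlgebra (k : fieldType) :=
  {L of Lmodule_isLieAlgebra k L & GRing.Lmodule k L}.

Lemma ring_commD (A : nzRingType) (a b c d : A) : a * d = d * a -> b * c = c * b ->
  (a + b) * (c + d) - (c + d) * (a + b) = (a * c - c * a) + (b * d - d * b).
Proof.
move=> h h'; rewrite !mulrDl !mulrDr h h'.
have -> : a * c + d * a + (c * b + b * d) = a * c + b * d + (d * a + c * b).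
  by rewrite [c * b + b * d]addrC addrACA.
have -> : c * a + c * b + (d * a + d * b) = c * a + d * b + (d * a + c * b).
  by rewrite [d * a + d * b]addrC addrACA [c * b + d * a]addrC.
rewrite [c * a + d * b + _]addrC addrKA opprD; exact: addrACA.
Qed.

Section UniversalEnveloping.
Variables (k : fieldType) (g : lieAlgType k).

(* U(g) as the free algebra on the set g modulo linearity of g -> U(g), which
   yields the tensor algebra of g, and the bracket relations. *)
Inductive U_rel : freealg k g -> Prop :=
| U_lin a x y : U_rel (fgen k (a *: x + y) - (a *: fgen k x + fgen k y))
| U_lie x y :
    U_rel (fgen k x * fgen k y - fgen k y * fgen k x - fgen k (lie x y)).

Lemma U_rel_ker (B : algType k) (f : g -> B) : linear f ->
  (forall x y, f (lie x y) = f x * f y - f y * f x) ->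
  forall w, U_rel w -> freelift f w = 0.
Proof.
move=> lf fL _ []; have [ll _ lM] := freelift_am f.
  by move=> a x y; rewrite (linB ll) ll !freelift_gen lf subrr.
move=> x y; rewrite [LHS](linB ll) freelift_gen fL -!(freelift_gen f) -!lM.
by rewrite -(linB ll) subrr.
Qed.

Lemma U_proper : ~ ideal_gen U_rel 1.
Proof.
apply: (ideal_gen_proper (freelift_am (fun _ : g => 0 : k^o))).
apply: U_rel_ker => [a x y|x y]; first by rewrite scaler0 addr0.
by rewrite mulr0 subrr.
Qed.

Definition U_ideal := gen_ideal U_proper.
Definition Ualg : algType k := quota U_ideal.

Definition Uin (x : g) : Ualg := qproj U_ideal (fgen k x).

Lemma Uin_linear : linear Uin.
Proof.
move=> a x y; rewrite /Uin -(am_lin (qproj_am U_ideal)).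
by rewrite qprojE; apply/qpiP/ideal_gen_gen/U_lin.
Qed.

Lemma Uin_lie x y : Uin (lie x y) = Uin x * Uin y - Uin y * Uin x.
Proof.
have [pl _ pM] := qproj_am U_ideal.
rewrite /Uin -!pM -(linB pl); apply/esym.
by rewrite qprojE; apply/qpiP/ideal_gen_gen/U_lie.
Qed.

Lemma Ualg_ind (P : Ualg -> Prop) :
  (forall a u v, P u -> P v -> P (a *: u + v)) -> P 1 ->
  (forall x u, P u -> P (Uin x * u)) -> forall u, P u.
Proof.
move=> PD P1 PM; have [pl p1 pM] := qproj_am U_ideal.
apply: qproj_ind; apply: freealg_ind => [a u v Pu Pv||x u Pu].
- by rewrite pl; apply: PD.
- by rewrite p1.
- by rewrite pM; apply: PM.
Qed.

(* The algebra map on U(g) induced by f; meaningful only when f is a Lie algebra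
   morphism to the commutator Lie algebra of B. *)
Definition Ulift (B : algType k) (f : g -> B) : Ualg -> B :=
  qlift U_ideal (freelift f).

Section Lift.
Variables (B : algType k) (f : g -> B).
Hypothesis lf : linear f.
Hypothesis fL : forall x y, f (lie x y) = f x * f y - f y * f x.

Lemma Ulift_ker w : U_ideal w -> freelift f w = 0.
Proof. exact: ideal_gen_ker (freelift_am f) (U_rel_ker lf fL) w. Qed.

Lemma Ulift_am : alg_morph (Ulift f).
Proof. exact: qlift_am (freelift_am f) Ulift_ker. Qed.

Lemma UliftE x : Ulift f (Uin x) = f x.
Proof.
rewrite -[RHS]freelift_gen.
exact: (qlift_proj _ (am_lin (freelift_am f)) Ulift_ker).
Qed.

End Lift.

Lemma eq_Ualg (B : algType k) (F G : Ualg -> B) : alg_morph F -> alg_morph G ->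
  (forall x, F (Uin x) = G (Uin x)) -> F =1 G.
Proof.
move=> [lF F1 FM] [lG G1 GM] FG; apply: Ualg_ind => [a u v hu hv||x u hu].
- by rewrite lF lG hu hv.
- by rewrite F1 G1.
- by rewrite FM GM FG hu.
Qed.

Definition Ucomul : Ualg -> Ualg ⊗ Ualg :=
  Ulift (fun x => Uin x ⊗ 1 + 1 ⊗ Uin x).
Definition Ucounit : Ualg -> k^o := Ulift (fun _ => 0 : k^o).
Definition Uantipode : Ualg -> Ualg :=
  Ulift (fun x => - Uin x : oppalg Ualg).

Let Ucomul_lin : linear (fun x => Uin x ⊗ 1 + 1 ⊗ Uin x : Ualg ⊗ Ualg).
Proof.
move=> a x y; rewrite Uin_linear (tpure_bilin _ _).1 (tpure_bilin _ _).2.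
by rewrite scalerDr addrACA.
Qed.

Let Ucomul_lie (x y : g) (d := fun x => Uin x ⊗ 1 + 1 ⊗ Uin x : Ualg ⊗ Ualg) :
  d (lie x y) = d x * d y - d y * d x.
Proof.
have l1 := (tpure_bilin Ualg Ualg).1 1; have l2 := (tpure_bilin Ualg Ualg).2 1.
rewrite /d ring_commD ?tpureM ?(mulr1, mul1r) //.
by rewrite Uin_lie (linB l1) (linB l2).
Qed.

Let Uantipode_lin : linear (fun x => - Uin x : oppalg Ualg).
Proof. by move=> a x y; rewrite Uin_linear opprD -[a *: (- _)]/(a *: (- _ : Ualg)) scalerN. Qed.

Let Uantipode_lie (x y : g) (d := fun x => - Uin x : oppalg Ualg) :
  d (lie x y) = d x * d y - d y * d x.
Proof.
rewrite /d Uin_lie opprB.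
by rewrite -[RHS]/((- Uin y : Ualg) * (- Uin x) - (- Uin x) * (- Uin y)) !mulrNN.
Qed.

Let zero_lin : linear (fun _ : g => 0 : k^o).
Proof. by move=> a x y; rewrite scaler0 addr0. Qed.

Let zero_lie (x y : g) : (0 : k^o) = 0 * 0 - 0 * 0.
Proof. by rewrite mulr0 subrr. Qed.

Lemma Ucomul_am : alg_morph Ucomul.
Proof. exact: Ulift_am Ucomul_lin Ucomul_lie. Qed.
Lemma UcomulE x : Ucomul (Uin x) = Uin x ⊗ 1 + 1 ⊗ Uin x.
Proof. exact: UliftE Ucomul_lin Ucomul_lie x. Qed.
Lemma Ucounit_am : alg_morph Ucounit.
Proof. exact: Ulift_am zero_lin zero_lie. Qed.
Lemma UcounitE x : Ucounit (Uin x) = 0.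
Proof. exact: UliftE zero_lin zero_lie x. Qed.
Lemma Uantipode_am : alg_morph (Uantipode : Ualg -> oppalg Ualg).
Proof. exact: Ulift_am Uantipode_lin Uantipode_lie. Qed.
Lemma UantipodeE x : Uantipode (Uin x) = - Uin x.
Proof. exact: UliftE Uantipode_lin Uantipode_lie x. Qed.
Lemma Uantipode_linear : linear Uantipode.
Proof. exact: am_lin Uantipode_am. Qed.
Lemma Uantipode1 : Uantipode 1 = 1.
Proof. exact: am1 Uantipode_am. Qed.
Lemma UantipodeM x y : Uantipode (x * y) = Uantipode y * Uantipode x.
Proof. exact: (amM Uantipode_am x y). Qed.

Lemma UcomulA x : tassoc (tmap Ucomul id (Ucomul x)) = tmap id Ucomul (Ucomul x).
Proof.
have cl := am_lin Ucomul_am; have c1 := am1 Ucomul_am.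
have il := @id_lin k Ualg.
have lL := tmap_linear cl il; have lR := tmap_linear il cl.
have lT := @tassoc_linear k Ualg Ualg Ualg.
move: x; apply: eq_Ualg => [||x].
- apply: am_comp; first exact: tassoc_am.
  by apply: am_comp Ucomul_am; apply: tmap_am Ucomul_am (am_id _).
- by apply: am_comp Ucomul_am; apply: tmap_am (am_id _) Ucomul_am.
rewrite UcomulE (linD lL) (linD lR) !tmapE // UcomulE c1.
rewrite (linD ((tpure_bilin _ _).1 _)) (linD ((tpure_bilin _ _).2 _)) !(linD lT).
by rewrite -!tpure1 !tassocE addrA.
Qed.

Lemma Ucounitl x : tlift (fun a b => (Ucounit a : k) *: b) (Ucomul x) = x.
Proof.
have [el e1 eM] := Ucounit_am.
have bl : bilin (fun a b : Ualg => (Ucounit a : k) *: b).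
  split=> [b a u v|a c u v]; first by rewrite el scalerDl -scalerA.
  by rewrite scalerDr !scalerA mulrC.
move: x; apply: eq_Ualg => [||x]; last first.
- rewrite UcomulE (linD (tlift_linear bl)) !(tliftE bl) UcounitE e1.
  by rewrite scale0r scale1r add0r.
- exact: am_id.
apply: am_comp Ucomul_am; apply: tens_am; first exact: tlift_linear.
  by rewrite (tliftE bl) e1 scale1r.
by move=> a b c d; rewrite !(tliftE bl) eM -scalerAl -scalerAr scalerA.
Qed.

Lemma Ucounitr x : tlift (fun a b => (Ucounit b : k) *: a) (Ucomul x) = x.
Proof.
have [el e1 eM] := Ucounit_am.
have bl : bilin (fun a b : Ualg => (Ucounit b : k) *: a).
  split=> [b c u v|a c u v]; last by rewrite el scalerDl -scalerA.
  by rewrite scalerDr !scalerA mulrC.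
move: x; apply: eq_Ualg => [||x]; last first.
- rewrite UcomulE (linD (tlift_linear bl)) !(tliftE bl) UcounitE e1.
  by rewrite scale0r scale1r addr0.
- exact: am_id.
apply: am_comp Ucomul_am; apply: tens_am; first exact: tlift_linear.
  by rewrite (tliftE bl) e1 scale1r.
by move=> a b c d; rewrite !(tliftE bl) eM -scalerAl -scalerAr scalerA.
Qed.

Lemma Uantipodel x :
  tlift (fun a b => Uantipode a * b) (Ucomul x) = (Ucounit x : k) *: 1.
Proof.
have [el e1 eM] := Ucounit_am; have [cl c1 cM] := Ucomul_am.
have sl := Uantipode_linear.
have bl : bilin (fun a b : Ualg => Uantipode a * b).
  split=> [b a u v|a c u v]; first by rewrite sl mulrDl scalerAl.
  by rewrite mulrDr scalerAr.
have tl := tlift_linear bl.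
elim/Ualg_ind: x => [a u v hu hv||x u hu].
- by rewrite cl tl hu hv el scalerDl scalerA.
- by rewrite c1 -tpure1 (tliftE bl) Uantipode1 mulr1 e1 scale1r.
rewrite cM eM UcounitE UcomulE mul0r scale0r.
move: (Ucomul u) => t; elim/tens_ind: t {hu} => [|a b t IH].
  by rewrite mulr0 (lin0 tl).
rewrite mulrDr (linD tl) IH addr0 mulrDl !tpureM (linD tl) !(tliftE bl) !mul1r.
by rewrite UantipodeM UantipodeE mulrN mulNr mulrA addNr.
Qed.

Lemma UcomulC x : tswap (Ucomul x) = Ucomul x.
Proof.
have bs := @tswap_bilin k Ualg Ualg.
move: x; apply: eq_Ualg => [||x].
- exact: am_comp (@tswap_am k Ualg Ualg) Ucomul_am.
- exact: Ucomul_am.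
by rewrite UcomulE /tswap (linD (tlift_linear bs)) !(tliftE bs) addrC.
Qed.

Lemma Uantipoder x :
  tlift (fun a b => a * Uantipode b) (Ucomul x) = (Ucounit x : k) *: 1.
Proof.
have [el e1 eM] := Ucounit_am; have [cl c1 cM] := Ucomul_am.
have sl := Uantipode_linear.
have bl : bilin (fun a b : Ualg => a * Uantipode b).
  split=> [b a u v|a c u v]; first by rewrite mulrDl scalerAl.
  by rewrite sl mulrDr scalerAr.
have tl := tlift_linear bl.
elim/Ualg_ind: x => [a u v hu hv||x u hu].
- by rewrite cl tl hu hv el scalerDl scalerA.
- by rewrite c1 -tpure1 (tliftE bl) Uantipode1 mulr1 e1 scale1r.
have h t : tlift (fun a b => a * Uantipode b) (Ucomul (Uin x) * t) =
    Uin x * tlift (fun a b => a * Uantipode b) t -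
    tlift (fun a b => a * Uantipode b) t * Uin x.
  rewrite UcomulE; elim/tens_ind: t => [|a b t IH].
    by rewrite mulr0 (lin0 tl) mulr0 mul0r subrr.
  rewrite mulrDr !(linD tl) IH mulrDl !tpureM (linD tl) !(tliftE bl) !mul1r.
  rewrite UantipodeM UantipodeE mulrDr mulrDl opprD mulrN mulrN !mulrA.
  exact: addrACA.
by rewrite cM h hu -scalerAr -scalerAl mulr1 mul1r subrr eM UcounitE mul0r scale0r.
Qed.

Definition Uhopf : cocommHopf k :=
  CocommHopf Ucomul_am Ucounit_am Uantipode_linear UcomulA Ucounitl Ucounitr
    Uantipodel Uantipoder UcomulC.

End UniversalEnveloping.

Section RestrictedLie.
Variables (k : fieldType) (g : lieAlgType k) (p : nat).

(* ad_(tx+y) on k[t] ⊗ g, whose elements are given by their coefficient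
   sequences. *)
Definition ad_t (x y : g) (f : nat -> g) : nat -> g :=
  fun n => (if n is m.+1 then lie x (f m) else 0) + lie y (f n).

Definition jacobson_s (i : nat) (x y : g) : g :=
  i%:R^-1 *: iter p.-1 (ad_t x y) (fun n => if n == 0%N then x else 0) i.-1.

Record is_pmap (pm : g -> g) : Prop := IsPmap {
  pmapZ : forall a x, pm (a *: x) = a ^+ p *: pm x;
  pmap_ad : forall x y, lie (pm x) y = iter p (lie x) y;
  pmapD : forall x y,
    pm (x + y) = pm x + pm y + \sum_(1 <= i < p) jacobson_s i x y }.

End RestrictedLie.

Section RotaBaxterLie.
Variables (k : fieldType) (g : lieAlgType k).

Record rota_baxter (lam : k) (R : g -> g) : Prop := RotaBaxter {
  rb_lin : linear R;
  rbE : forall x y,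
    lie (R x) (R y) = R (lie (R x) y) + R (lie x (R y)) + lam *: R (lie x y) }.

Definition is_composition (n : nat) (a : seq nat) : bool :=
  all (leq 1) a && (sumn a == n).

Definition comp_coef (a : seq nat) : nat :=
  (\prod_(j < size a) 'C((sumn (take j.+1 a)).-1, (nth 0 a j).-1))%N.

Definition rb_pow (R : g -> g) (x : g) (n : nat) : g := iter n.-1 (lie (R x)) x.

Fixpoint lie_nest (s : seq g) : g :=
  match s with
  | [::] => 0
  | [:: x] => x
  | x :: s' => lie x (lie_nest s')
  end.

(* The entries of a composition of p are at most p, hence the range of a. *)
Definition rb_pmap (p : nat) (lam : k) (pm R : g -> g) (x : g) : g :=
  lam ^+ p.-1 *: pm x +
  \sum_(1 <= r < p) (r%:R^-1 * lam ^+ r.-1) *: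
    \sum_(a : r.-tuple 'I_p.+1 | is_composition p (map val a))
      (comp_coef (map val a))%:R *: lie_nest [seq rb_pow R x (val i) | i <- a].

Record restricted_rota_baxter (p : nat) (lam : k) (pm R : g -> g) : Prop :=
  RestrictedRotaBaxter {
    rrb_pmap : is_pmap p pm;
    rrb_rb : rota_baxter lam R;
    rrbE : forall x, R (rb_pmap p lam pm R x) = pm (R x) }.

End RotaBaxterLie.

Section RestrictedEnveloping.
Variables (k : fieldType) (p : nat) (charkp : p \in [pchar k]).
Variables (g : lieAlgType k) (pm : g -> g).

Inductive u_rel : Ualg g -> Prop :=
| u_pmap x : u_rel (Uin x ^+ p - Uin (pm x)).

Lemma pchar_alg (A : algType k) : p \in [pchar A].
Proof.
have /andP[pp /eqP p0] := charkp.
by apply/andP; split=> //; rewrite -scaler_nat p0 scale0r.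
Qed.

Let p_gt0 : (0 < p)%N.
Proof. by have /andP[/prime_gt0] := charkp. Qed.

Lemma u_rel_counit x : u_rel x -> Ucounit x = 0.
Proof.
have ea := Ucounit_am g; case=> {}x.
by rewrite (linB (am_lin ea)) amX // !UcounitE expr0n eqn0Ngt p_gt0 subrr.
Qed.

Lemma u_proper : ~ ideal_gen u_rel 1.
Proof. exact: ideal_gen_proper (Ucounit_am g) u_rel_counit. Qed.

Definition u_ideal := gen_ideal u_proper.

Lemma u_rel_proj x : u_rel x -> qproj u_ideal x = 0.
Proof.
move=> ux; rewrite -(lin0 (am_lin (qproj_am u_ideal))) qprojE.
by apply/qpiP; rewrite subr0; apply: ideal_gen_gen.
Qed.

Lemma u_ideal_comul x :
  u_ideal x -> tmap (qproj u_ideal) (qproj u_ideal) (comul (Uhopf g) x) = 0.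
Proof.
have pa := qproj_am u_ideal; have pl := am_lin pa.
have ta := tmap_am pa pa; have fa := am_comp ta (Ucomul_am g).
apply: (ideal_gen_ker fa) => _ [y]; rewrite (linB (am_lin fa)) (amX _ _ fa).
have e (z : g) : tmap (qproj u_ideal) (qproj u_ideal) (Ucomul (Uin z)) =
    qproj u_ideal (Uin z) ⊗ 1 + 1 ⊗ qproj u_ideal (Uin z).
  by rewrite UcomulE (linD (am_lin ta)) !tmapE // (am1 pa).
rewrite [X in X ^+ p]e [X in _ - X]e.
have h : qproj u_ideal (Uin (pm y)) = qproj u_ideal (Uin y) ^+ p.
  apply/esym/eqP; rewrite -subr_eq0 -(amX _ _ pa) -(linB pl); apply/eqP.
  exact/u_rel_proj/u_pmap.
have chu := pchar_alg (quota u_ideal ⊗ quota u_ideal)%type.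
have cm (a : quota u_ideal) : GRing.comm (a ⊗ 1 : quota u_ideal ⊗ quota u_ideal) (1 ⊗ a).
  by rewrite /GRing.comm !tpureM !mulr1 !mul1r.
have xl (a : quota u_ideal) n : (a ⊗ 1 : quota u_ideal ⊗ quota u_ideal) ^+ n = a ^+ n ⊗ 1.
  by elim: n => [|n IH]; rewrite ?expr0 // !exprS IH tpureM mulr1.
have xr (a : quota u_ideal) n : (1 ⊗ a : quota u_ideal ⊗ quota u_ideal) ^+ n = 1 ⊗ a ^+ n.
  by elim: n => [|n IH]; rewrite ?expr0 // !exprS IH tpureM mulr1.
rewrite -(pFrobenius_autE chu) pFrobenius_autD_comm // !pFrobenius_autE.
by rewrite xl xr h subrr.
Qed.

Lemma u_ideal_counit x : u_ideal x -> counit (Uhopf g) x = 0.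
Proof. exact: ideal_gen_ker (Ucounit_am g) u_rel_counit x. Qed.

Lemma u_ideal_antipode x :
  u_ideal x -> qproj u_ideal (antipode (Uhopf g) x) = 0.
Proof.
rewrite /=; elim=> {x} [_ [y]||a x z _ hx _ hz|a x _ h|a x _ h].
- have := Uantipode_am g => sa.
  rewrite (linB (Uantipode_linear (g:=g))) UantipodeE.
  have -> : Uantipode (Uin y ^+ p) = Uantipode (Uin y) ^+ p.
    elim: p => [|n IH]; first exact: Uantipode1.
    by rewrite exprS exprSr UantipodeM IH.
  rewrite UantipodeE -(pFrobenius_autE (pchar_alg (Ualg g))) pFrobenius_autN.
  rewrite pFrobenius_autE -opprD -scaleN1r (linZ (am_lin (qproj_am u_ideal))).
  rewrite u_rel_proj ?scaler0 //; exact: u_pmap.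
- by rewrite (lin0 (Uantipode_linear (g:=g))) (lin0 (am_lin (qproj_am u_ideal))).
- by rewrite Uantipode_linear (am_lin (qproj_am u_ideal)) hx hz scaler0 addr0.
- by rewrite UantipodeM (amM (qproj_am u_ideal)) h mul0r.
- by rewrite UantipodeM (amM (qproj_am u_ideal)) h mulr0.
Qed.

Definition uhopf : cocommHopf k :=
  @hopf_quot k (Uhopf g) u_ideal u_ideal_comul u_ideal_counit u_ideal_antipode.

Definition u_proj : Uhopf g -> uhopf := qproj u_ideal.

End RestrictedEnveloping.

Section RotaBaxterHopf.
Variables (k : fieldType) (H : cocommHopf k).

(* f(x_1, x_2, x_3) in Sweedler notation, for a trilinear f. *)
Definition sweedler3 (W : lmodType k) (f : H -> H -> H -> W) (x : H) : W :=
  tlift (fun a bc => tlift (f a) bc) (tmap id (comul H) (comul H x)).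

Record coalg_endo (R : H -> H) : Prop := CoalgEndo {
  ce_lin : linear R;
  ce_comul : forall x, comul H (R x) = tmap R R (comul H x);
  ce_counit : forall x, counit H (R x) = counit H x }.

Record rota_baxter_hopf (R : H -> H) : Prop := RotaBaxterHopf {
  rbh_coalg : coalg_endo R;
  rbhE : forall x y,
    R x * R y = R (sweedler3 (fun a b c => a * R b * y * antipode H (R c)) x) }.

Record hopf_endo (R : H -> H) : Prop := HopfEndo {
  he_alg : alg_morph R;
  he_coalg : coalg_endo R;
  he_antipode : forall x, R (antipode H x) = antipode H (R x) }.

End RotaBaxterHopf.

(* Goncharov's extension of R to U(g). *)
Record rb_extension (k : fieldType) (g : lieAlgType k) (R : g -> g)
    (RU : Uhopf g -> Uhopf g) : Prop := RbExtension {
  rbext_rb : rota_baxter_hopf RU;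
  rbext_in : forall x : g, RU (Uin x) = Uin (R x);
  rbext1 : RU 1 = 1;
  rbextM : forall (x : g) (y : Uhopf g),
    RU (Uin x * y) =
      RU (Uin x) * RU y - RU (RU (Uin x) * y - y * RU (Uin x)) }.

(* Main.v *)
(* Fix x and let c = R(x). The operator T u = x u + [c, u] = (x + c) u - u c on U(g)
   satisfies R(T u) = c R(u). In characteristic p its p-th power is
   T^p u = (x + c)^p u - u c^p, and Jacobson's formula gives
   (x + c)^p = x^p + c^p + s with s = sum_i s_i(x, c). The sum over compositions
   that defines x^{[p]_R} is an expansion of the Lie polynomials s_i, so that
   x^{[p]_R} = x^{[p]} + s. With the central elements z_x = x^p - x^{[p]}, comparing
   R(T^p u) = c^p R(u) with R(v u) = R(v) R(u) - R([R(v), u]) for v = x^{[p]_R},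
   R(v) = c^{[p]}, yields R(z_x u) = z_{R(x)} R(u); hence R preserves the ideal
   generated by the z_x.

   If R is idempotent and p <> 2, then R vanishes on brackets and its image is
   abelian, so R([R(x), u]) = 0 on U(g) and R is multiplicative. *)
Require Import Defs.
From HB Require Import structures.
From mathcomp Require Import all_boot all_algebra boolp.

Set Implicit Arguments.
Unset Strict Implicit.
Unset Printing Implicit Defensive.

Import GRing.Theory.
Local Open Scope ring_scope.

(** * Iterates of the operator sending [u] to [a * u - u * b] *)

Section MulDifference.
Variables (A : nzRingType) (a b : A).

(** Left multiplication by [a] and right multiplication by [b] commute, so this is the binomial
    theorem for their difference. *)
Lemma iter_mulB n q : iter n (fun u => a * u - u * b) q =
  \sum_(i < n.+1) (-1) ^+ i * (a ^+ (n - i) * q * b ^+ i) *+ 'C(n, i).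
Proof.
elim: n => [|n IH]; first by rewrite big_ord1 !expr0 !mul1r mulr1.
rewrite iterS IH mulr_sumr mulr_suml.
pose t i := (-1) ^+ i * (a ^+ (n.+1 - i) * q * b ^+ i).
have -> : \sum_(i < n.+1) a * ((-1) ^+ i * (a ^+ (n - i) * q * b ^+ i) *+ 'C(n, i)) =
    t 0 + \sum_(i < n.+1) t i.+1 *+ 'C(n, i.+1).
  transitivity (\sum_(i < n.+2) t i *+ 'C(n, i)).
    rewrite [RHS]big_ord_recr /= bin_small // mulr0n addr0; apply: eq_bigr => i _.
    rewrite mulrnAr /t subSn -1?ltnS // exprS !mulrA.
    by congr (_ * _ * _ * _ *+ _); exact: commr_sign.
  by rewrite big_ord_recl bin0.
have -> : \sum_(i < n.+1) (-1) ^+ i * (a ^+ (n - i) * q * b ^+ i) *+ 'C(n, i) * b =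
    - \sum_(i < n.+1) t i.+1 *+ 'C(n, i).
  rewrite -sumrN; apply: eq_bigr => i _; rewrite /t subSS exprS mulN1r mulNr mulNrn opprK.
  by rewrite exprSr mulrnAl !mulrA.
rewrite opprK [RHS]big_ord_recl bin0 mulr1n -addrA -big_split; congr (_ + _).
by apply: eq_bigr => i _; rewrite /= -mulrnDr binS.
Qed.

Variables (p : nat) (charAp : p \in [pchar A]).

(** By Pascal's rule two neighbours in row $p-1$ add up to an inner entry of row $p$, which $p$
    divides; so the entries alternate in sign. *)
Lemma sign_bin_pchar i : (i < p)%N -> (-1) ^+ i *+ 'C(p.-1, i) = 1 :> A.
Proof.
have /andP[pp _] := charAp.
elim: i => [|i IH] ip; first by rewrite bin0.
have := IH (ltnW ip) => e.
have : (-1 : A) ^+ i *+ 'C(p, i.+1) = 0.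
  have /dvdnP[m ->] := @prime_dvd_bin i.+1 p pp ip.
  by rewrite mulrnA mulrn_pchar.
rewrite -{1}(prednK (prime_gt0 pp)) binS mulrnDr e => /eqP.
by rewrite addr_eq0 => /eqP h; rewrite exprS mulN1r mulNrn h opprK.
Qed.

Lemma iter_mulB_pchar q : iter p (fun u => a * u - u * b) q = a ^+ p * q - q * b ^+ p.
Proof.
have /andP[pp _] := charAp.
case: p charAp pp => // n chA pp.
rewrite iter_mulB big_ord_recl big_ord_recr /= big1 ?add0r; last first.
  move=> i _; have /dvdnP[m ->] := @prime_dvd_bin (bump 0 i) n.+1 pp (ltn_ord i).
  by rewrite mulrnA mulrn_pchar.
rewrite /bump /= add1n subnn bin0 binn subn0 !expr0 !mul1r mulr1; congr (_ + _).
(* Frobenius gives $(-1)^p = -1$, also when $p = 2$. *)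
by rewrite -(pFrobenius_autE chA (-1)) pFrobenius_autN pFrobenius_aut1 mulN1r.
Qed.

Lemma iter_mulB_pred_pchar q :
  iter p.-1 (fun u => a * u - u * b) q = \sum_(i < p) a ^+ (p.-1 - i) * q * b ^+ i.
Proof.
have /andP[pp _] := charAp.
rewrite iter_mulB (prednK (prime_gt0 pp)); apply: eq_bigr => i _.
by rewrite -mulrnAl sign_bin_pchar // mul1r.
Qed.

End MulDifference.

(** * Powers of $aX + b$ with noncommuting coefficients *)

Section LinearPolynomialPowers.
Variables (A : nzRingType) (a b : A).
Let P : {poly A} := a%:P * 'X + b%:P.

Lemma coef_linpM (Q : {poly A}) i :
  (P * Q)`_i = (if i is j.+1 then a * Q`_j else 0) + b * Q`_i.
Proof.
rewrite mulrDl -mulrA -commr_polyX coefD !coefCM coefMX.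
by case: i => //=; rewrite mulr0.
Qed.

Lemma coef_Mlinp (Q : {poly A}) i :
  (Q * P)`_i = (if i is j.+1 then Q`_j * a else 0) + Q`_i * b.
Proof. by rewrite mulrDr mulrA coefD coefMX !coefMC; case: i. Qed.

Lemma coef_linpX_gt n i : (n < i)%N -> (P ^+ n)`_i = 0.
Proof.
elim: n i => [|n IH] [|i] // ni; first by rewrite expr0 coef1.
by rewrite exprS coef_linpM !IH ?mulr0 ?addr0 // ltnW.
Qed.

Lemma coef0_linpX n : (P ^+ n)`_0 = b ^+ n.
Proof.
elim: n => [|n IH]; first by rewrite !expr0 coef1.
by rewrite !exprS coef_linpM IH add0r.
Qed.

Lemma coefn_linpX n : (P ^+ n)`_n = a ^+ n.
Proof.
elim: n => [|n IH]; first by rewrite !expr0 coef1.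
by rewrite !exprS coef_linpM IH coef_linpX_gt // mulr0 addr0.
Qed.

(** Evaluation at 1 respects products over the noncommutative [A] because 1 commutes with
    everything. *)
Lemma horner_linpX n : (a + b) ^+ n = \sum_(i < n.+1) (P ^+ n)`_i.
Proof.
have h : (P ^+ n).[1] = (a + b) ^+ n.
  elim: n => [|n IH]; first by rewrite !expr0 hornerC.
  rewrite !exprSr hornerM_comm; last by apply/commr_sym/commr1.
  rewrite IH hornerD hornerC hornerM_comm ?hornerX ?hornerC ?mulr1 //.
  exact/commr_sym/commr1.
rewrite -h (@horner_coef_wide _ n.+1).
  by apply: eq_bigr => i _; rewrite expr1n mulr1.
by apply/leq_sizeP => i; apply: coef_linpX_gt.
Qed.

(** Since [a] need not commute with [P], the Leibniz rule keeps one summand for each position of the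
    differentiated factor. *)
Lemma deriv_linpX n : (P ^+ n)^`() = \sum_(i < n) P ^+ (n.-1 - i) * a%:P * P ^+ i.
Proof.
have dP : P^`() = a%:P.
  by rewrite derivD derivM !derivC derivX mul0r add0r mulr1 addr0.
elim: n => [|n IH]; first by rewrite big_ord0 expr0 derivC.
rewrite exprS derivM dP IH mulr_sumr big_ord_recr /= subnn expr0 mul1r addrC.
congr (_ + _); apply: eq_bigr => i _; rewrite !mulrA -exprS; congr (_ ^+ _ * _ * _).
by case: n {IH} i => [[]//|n] i /=; rewrite subSn // -ltnS.
Qed.

End LinearPolynomialPowers.

(** * Jacobson's formula for the $p$-th power of a sum *)

Section JacobsonFormula.
Variables (k : fieldType) (p : nat) (charkp : p \in [pchar k]).
Variables (g : lieAlgType k) (A : algType k) (f : g -> A).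
Hypothesis lf : linear f.
Hypothesis fL : forall x y, f (lie x y) = f x * f y - f y * f x.

(** Applied coefficientwise, [f] turns [ad_t x y] into the commutator with [P], because ['X] is
    central. *)
Lemma coef_iter_ad_linp x y n i (P := (f x)%:P * 'X + (f y)%:P) :
  (iter n (fun Q => P * Q - Q * P) (f x)%:P)`_i =
    f (iter n (ad_t x y) (fun j => if j == 0%N then x else 0) i).
Proof.
elim: n i => [|n IH] i /=.
  by rewrite coefC; case: eqP => // _; rewrite (lin0 lf).
rewrite coefB coef_linpM coef_Mlinp IH /ad_t (linD lf) fL opprD addrACA.
by case: i => [|i]; rewrite ?(lin0 lf) ?subrr // fL IH.
Qed.

(** In characteristic $p$ the derivative of $P^p$ is the commutator with $P$ applied $p-1$ times to
    [f x]. Its coefficients determine those of $P^p$ in degrees $0 < i < p$ after division by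
    $i$. *)
Lemma jacobson_formula x y :
  (f x + f y) ^+ p =
    f x ^+ p + f y ^+ p + f (\sum_(1 <= i < p) jacobson_s p i x y).
Proof.
have /andP[pp _] := charkp; have p1 := prime_gt1 pp; have p0 := prime_gt0 pp.
pose P := (f x)%:P * 'X + (f y)%:P.
have chP : p \in [pchar {poly A}].
  by have /andP[_ h] := pchar_alg charkp A; rewrite inE pp -polyC_natr (eqP h) polyC0 /=.
(* The outer coefficients are the two $p$-th powers; only the inner ones remain. *)
rewrite horner_linpX -/P -(big_mkord xpredT (fun i => (P ^+ p)`_i)).
rewrite big_nat_recr //= big_ltn // coef0_linpX coefn_linpX addrC addrA; congr (_ + _).
have -> : f (\sum_(1 <= i < p) jacobson_s p i x y) =
    \sum_(1 <= i < p) f (jacobson_s p i x y).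
  by apply: (big_morph f (linD lf) (lin0 lf)).
apply: eq_big_nat => -[//|i] /andP[_ ip].
have := congr1 (fun Q : {poly A} => Q`_i) (deriv_linpX (f x) (f y) p).
rewrite /= -iter_mulB_pred_pchar // coef_iter_ad_linp coef_deriv => h.
have i0 : i.+1%:R != 0 :> k.
  rewrite -(dvdn_pcharf charkp); apply/negP => /dvdn_leq => /(_ isT).
  by rewrite leqNgt ip.
by rewrite /jacobson_s (linZ lf) -h -scaler_nat scalerA mulVf // scale1r.
Qed.

End JacobsonFormula.

(** * Sums over compositions weighted by $C_\alpha$ *)

Section CompositionSums.
Variable V : nmodType.
Implicit Types f h : seq nat -> V.

(* The sum of C_α f(α_1 - 1, ..., α_r - 1) over the compositions α of n of length
   r, by recursion on the last part. *)
Fixpoint compsum (r n : nat) f : V :=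
  if r is r'.+1 then
    \sum_(j < n) compsum r' (n - j.+1) (fun w => f (rcons w j)) *+ 'C(n.-1, j)
  else if n == 0%N then f [::] else 0.

Arguments compsum : simpl never.

Lemma compsum0 n f : compsum 0 n f = if n == 0%N then f [::] else 0.
Proof. by []. Qed.

Lemma compsumS r n f : compsum r.+1 n f =
  \sum_(j < n) compsum r (n - j.+1) (fun w => f (rcons w j)) *+ 'C(n.-1, j).
Proof. by []. Qed.

Lemma eq_compsum r n f h : (forall w, size w = r -> f w = h w) ->
  compsum r n f = compsum r n h.
Proof.
elim: r n f h => [|r IH] n f h e; first by rewrite !compsum0 e.
apply: eq_bigr => j _; congr (_ *+ _); apply: IH => w sw.
by apply: e; rewrite size_rcons sw.
Qed.

Lemma compsumD r n f h :
  compsum r n (fun w => f w + h w) = compsum r n f + compsum r n h.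
Proof.
elim: r n f h => [|r IH] n f h; first by rewrite !compsum0; case: eqP; rewrite ?addr0.
by rewrite !compsumS -big_split; apply: eq_bigr => j _; rewrite IH mulrnDl.
Qed.

Lemma compsum_nil r f : compsum r.+1 0 f = 0.
Proof. by rewrite compsumS big_ord0. Qed.

Lemma compsum_single q f : compsum 1 q.+1 f = f [:: q].
Proof.
rewrite compsumS big_ord_recr /= subnn binn big1 ?add0r // => i _.
by rewrite compsum0 subSS subn_eq0 leqNgt ltn_ord mul0rn.
Qed.

(** The Leibniz rule for a derivation $D$ on words in which the letter $j$ stands for $D^j x$. *)
Definition word_deriv f (w : seq nat) : V := \sum_(i < size w) f (incr_nth w i).

Lemma word_deriv_rcons f w j :
  word_deriv f (rcons w j) = word_deriv (fun w => f (rcons w j)) w + f (rcons w j.+1).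
Proof.
have incrl n : (n < size w)%N -> incr_nth (rcons w j) n = rcons (incr_nth w n) j.
  by elim: w n => [|a w IH] [|n] //= nw; rewrite IH.
have incrr : incr_nth (rcons w j) (size w) = rcons w j.+1.
  by elim: w {incrl} => //= a w ->.
rewrite /word_deriv size_rcons big_ord_recr /= incrr; congr (_ + _).
by apply: eq_bigr => i _; rewrite incrl.
Qed.

(* C_α counts the set partitions of {1..n} whose blocks, ordered by their maxima,
   have sizes α_1, ..., α_r. The point 1 is either a singleton block, which is then
   the first one, or it can be removed from its block without changing the order. *)
Lemma compsum_front r n f :
  compsum r.+1 n.+1 f =
    compsum r n (fun w => f (0%N :: w)) + compsum r.+1 n (word_deriv f).
Proof.
elim: r n f => [|r IH] [|m] f.
- by rewrite compsum_single compsum_nil addr0.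
- by rewrite !compsum_single compsum0 add0r /word_deriv big_ord1.
- by rewrite compsumS big_ord1 !compsum_nil addr0.
have -> : compsum r.+2 m.+1 (word_deriv f) = \sum_(j < m.+1)
   (compsum r.+1 (m - j) (word_deriv (fun w => f (rcons w j))) +
    compsum r.+1 (m - j) (fun w => f (rcons w j.+1))) *+ 'C(m, j).
  rewrite compsumS; apply: eq_bigr => j _; rewrite -compsumD; congr (_ *+ _).
  by apply: eq_compsum => w _; rewrite word_deriv_rcons.
have -> : compsum r.+1 m.+1 (fun w => f (0%N :: w)) = \sum_(j < m.+1)
    compsum r (m - j) (fun w => f (0%N :: rcons w j)) *+ 'C(m, j).
  by rewrite compsumS.
rewrite -big_split.
transitivity (\sum_(j < m.+1) (compsum r.+1 (m - j).+1 (fun w => f (rcons w j))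
    + compsum r.+1 (m - j) (fun w => f (rcons w j.+1))) *+ 'C(m, j)); last first.
  by apply: eq_bigr => j _; rewrite IH /= -mulrnDl addrA.
(* The two summands differ by a shift of [j], so Pascal's rule merges them. *)
pose t j := compsum r.+1 (m.+1 - j) (fun w => f (rcons w j)).
transitivity (\sum_(j < m.+1) (t j + t j.+1) *+ 'C(m, j)); last first.
  by apply: eq_bigr => j _; rewrite /t subSS subSn // -ltnS.
rewrite compsumS -/(\sum_(j < m.+2) t j *+ 'C(m.+1, j)).
under [RHS]eq_bigr do rewrite mulrnDl.
rewrite big_split /= big_ord_recl bin0.
have -> : \sum_(i < m.+1) t i *+ 'C(m, i) = t 0%N + \sum_(i < m.+1) t i.+1 *+ 'C(m, i.+1).
  transitivity (\sum_(i < m.+2) t i *+ 'C(m, i)); last by rewrite big_ord_recl bin0.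
  by rewrite [RHS]big_ord_recr /= bin_small // mulr0n addr0.
rewrite -[RHS]addrA; congr (_ + _); rewrite -big_split.
by apply: eq_bigr => i _; rewrite binS mulrnDr.
Qed.

Lemma is_composition_rcons n a j : is_composition n (rcons a j) =
  [&& (0 < j)%N, (j <= n)%N & is_composition (n - j) a].
Proof.
rewrite /is_composition all_rcons sumn_rcons -andbA; case: (0 < j)%N => //=.
case: leqP => jn /=.
  by rewrite -(eqn_add2r j (sumn a)) subnK.
by apply/negP => /andP[_ /eqP e]; move: jn; rewrite -e ltnNge leq_addl.
Qed.

Lemma comp_coef_rcons a j :
  comp_coef (rcons a j) = (comp_coef a * 'C((sumn a + j).-1, j.-1))%N.
Proof.
rewrite /comp_coef size_rcons big_ord_recr /= nth_rcons ltnn eqxx.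
rewrite take_oversize ?size_rcons // sumn_rcons; congr (_ * _)%N.
apply: eq_bigr => i _; rewrite nth_rcons ltn_ord -cats1 takel_cat //.
Qed.

(** Splitting off the last part gives the recursion of [compsum], whose letters are parts minus one.
    The bound [B] is separate from [n] because the induction shrinks [n] while the range of the
    entries stays fixed. *)
Lemma sum_compositionsE B r n f : (n <= B)%N ->
  \sum_(a : r.-tuple 'I_B.+1 | is_composition n (map val a))
    f (map val a) *+ comp_coef (map val a) = compsum r n (fun w => f (map succn w)).
Proof.
elim: r n f => [|r IH] n f nB.
  rewrite (eq_bigl (fun a => (a == [tuple]) && (n == 0%N))); last first.
    by move=> a; rewrite tuple0 eqxx /= /is_composition /= eq_sym.
  rewrite big_mkcondr big_pred1_eq compsum0; case: eqP => //= _.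
  by rewrite /comp_coef big_ord0.
pose cons' (ja : 'I_B.+1 * r.-tuple 'I_B.+1) := [tuple of rcons ja.2 ja.1].
have bij : bijective cons'.
  (* The tuple is nonempty, so the default [ord0] is never returned. *)
  exists (fun a : r.+1.-tuple 'I_B.+1 =>
    (last ord0 a, [tuple of belast (head ord0 a) (behead a)])).
    case=> j a; congr (_, _); first by rewrite /= last_rcons.
    by apply: val_inj => /=; case: a => s /= _; case: s => //= i s; rewrite belast_rcons.
  case/tupleP => i a; apply: val_inj => /=.
  by rewrite -lastI.
rewrite (reindex cons') /=; last exact: onW_bij.
rewrite (eq_bigl (fun ja : 'I_B.+1 * r.-tuple 'I_B.+1 => ((0 < ja.1)%N && (ja.1 <= n)%N) &&
    is_composition (n - ja.1) (map val ja.2))); last first.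
  by move=> [j a]; rewrite map_rcons is_composition_rcons -andbA.
rewrite -(pair_big_dep (fun j : 'I_B.+1 => (0 < j)%N && (j <= n)%N)
  (fun (j : 'I_B.+1) (a : r.-tuple 'I_B.+1) => is_composition (n - j) (map val a))
  (fun j a => f (map val (rcons a j)) *+ comp_coef (map val (rcons a j)))) /=.
(* Parts are positive: the value 0 drops out, and index [j] now stands for the part [j.+1]. *)
rewrite big_mkcond big_ord_recl /= add0r -big_mkcond.
rewrite compsumS (big_ord_widen B (fun j => compsum r (n - j.+1)
  (fun w => f (map succn (rcons w j))) *+ 'C(n.-1, j)) nB).
apply: eq_bigr => j jn.
under [in RHS]eq_compsum do rewrite map_rcons.
rewrite -(IH _ (fun w => f (rcons w j.+1))); last exact: leq_trans (leq_subr _ _) nB.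
rewrite -sumrMnl; apply: eq_bigr => a /andP[_ /eqP sa].
rewrite !map_rcons comp_coef_rcons mulrnA sa /= subnK //.
Qed.

End CompositionSums.

Lemma compsum_additive (V W : zmodType) (h : {additive V -> W}) r n f :
  compsum r n (fun w => h (f w)) = h (compsum r n f).
Proof.
elim: r n f => [|r IH] n f; first by rewrite !compsum0; case: eqP; rewrite ?raddf0.
by rewrite !compsumS raddf_sum; apply: eq_bigr => j _; rewrite raddfMn IH.
Qed.

(** * The map $x^{[p]_R}$ of weight 1 through Jacobson's Lie polynomials *)

Section RotaBaxterPmap.
Variables (k : fieldType) (g : lieAlgType k).
Implicit Types x y : g.

Lemma lieC x y : lie x y = - lie y x.
Proof.
apply/eqP; rewrite -addr_eq0; apply/eqP.
have := liexx (x + y); rewrite (linD (lie_linl _)) !(linD (lie_linr _)) !liexx.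
by rewrite add0r addr0.
Qed.

Lemma lie_derivation x y z : lie x (lie y z) = lie (lie x y) z + lie y (lie x z).
Proof.
have /eqP := lie_jacobi x y z; rewrite -addrA addr_eq0 => /eqP ->.
rewrite opprD addrC -lieC; congr (_ + _).
by rewrite (lieC z x) -[- lie x z]scaleN1r (linZ (lie_linr _)) scaleN1r opprK.
Qed.

(** The letter $j$ stands for $(\mathrm{ad}_y)^j(x)$, which for $y = R(x)$ is $x^{\rhd_R (j+1)}$. *)
Let nested x y (w : seq nat) : g := lie_nest [seq iter j (lie y) x | j <- w].

Lemma word_deriv_nested x y w : word_deriv (nested x y) w = lie y (nested x y w).
Proof.
rewrite /word_deriv; elim: w => [|a w IH].
  by rewrite big_ord0 (lin0 (lie_linr _)).
rewrite [size _]/= big_ord_recl /=.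
case: w IH => [|b w] IH; first by rewrite big_ord0 addr0.
rewrite -[nested x y (a :: b :: w)]/(lie (iter a (lie y) x) (nested x y (b :: w))).
rewrite lie_derivation -IH; congr (_ + _).
rewrite (big_morph _ (linD (lie_linr _)) (lin0 (lie_linr _))).
apply: eq_bigr => i _; rewrite /nested /=.
(* [lie_nest] unfolds only once the raised tail is visibly nonempty. *)
by case: (nat_of_ord i).
Qed.

(** Applying $\mathrm{ad}_{tx+y}$ once more either prepends the letter 0 and raises the degree in
    $t$, or differentiates the word by $y$; this is the recursion of [compsum_front]. The
    coefficient of $t^i$ involves $i+1$ copies of $x$, hence words of length $i+1$. *)
Lemma ad_t_compsum x y n i :
  iter n (ad_t x y) (fun j => if j == 0%N then x else 0) i =
    compsum i.+1 n.+1 (nested x y).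
Proof.
have lie_compsum z r m (f : seq nat -> g) :
    compsum r m (fun w => lie z (f w)) = lie z (compsum r m f).
  pose h : {linear g -> g} := HB.pack (lie z) (GRing.isLinear.Build k g g _ _ (lie_linr z)).
  exact: (compsum_additive h).
elim: n i => [|n IH] i.
  rewrite compsum_front compsum_nil addr0.
  by case: i => [|i] //; rewrite compsum_nil.
rewrite iterS compsum_front /ad_t !IH; congr (_ + _); last first.
  by rewrite -lie_compsum; apply: eq_compsum => w _; rewrite word_deriv_nested.
(* For degree 0 both sides vanish; otherwise the words are nonempty, and prepending the letter 0 is
   bracketing with [x]. *)
case: i => // i; rewrite IH -lie_compsum; apply: eq_compsum => -[|b w] //.
Qed.

Lemma rb_pmapE p (pm R : g -> g) x : (0 < p)%N ->
  rb_pmap p 1 pm R x = pm x + \sum_(1 <= r < p) jacobson_s p r x (R x).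
Proof.
move=> p0; rewrite /rb_pmap expr1n scale1r; congr (_ + _).
apply: eq_big_nat => -[//|r] _; rewrite expr1n mulr1 /jacobson_s ad_t_compsum.
rewrite (prednK p0); congr (_ *: _).
pose f (s : seq nat) := lie_nest [seq rb_pow R x i | i <- s].
transitivity (\sum_(a : r.+1.-tuple 'I_p.+1 | is_composition p (map val a))
    f (map val a) *+ comp_coef (map val a)).
  by apply: eq_bigr => a _; rewrite scaler_nat /f -map_comp.
rewrite sum_compositionsE //; apply: eq_compsum => w _.
by rewrite /f -map_comp.
Qed.

End RotaBaxterPmap.

(** * Multiplicativity of the extension of an idempotent operator *)

Section IdempotentExtension.
Variables (k : fieldType) (g : lieAlgType k) (R : g -> g).
Hypothesis rbR : rota_baxter 1 R.
Hypothesis RR : forall x, R (R x) = R x.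
Hypothesis k2 : 2%:R != 0 :> k.

Let mul2_eq0 (x : g) : x + x = 0 -> x = 0.
Proof.
rewrite -mulr2n -scaler_nat => /eqP; rewrite scaler_eq0 (negPf k2) /=.
by move/eqP.
Qed.

(** The Rota-Baxter identity is used at [(R a, R b)], then [(R a, b)], then [(x, y)]. Idempotence
    turns the first two uses into relations $2v = 0$. *)
Lemma idem_rb_lie x y : R (lie x y) = 0.
Proof.
have rb := rbE rbR.
have rRR a b : R (lie (R a) (R b)) = 0.
  apply: mul2_eq0; apply: (addIr (R (lie (R a) (R b)))); rewrite add0r.
  have e := rb (R a) (R b); rewrite !RR scale1r in e.
  (* Applying [R] to the identity [e] gives $v = 3v$ for $v = R([R(a),R(b)])$. *)
  by rewrite {4}e !(linD (rb_lin rbR)) !RR.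
have cRR a b : lie (R a) (R b) = 0.
  by have := rb (R a) (R b); rewrite !RR !rRR scale1r !addr0.
have rR a b : R (lie (R a) b) = 0.
  apply: mul2_eq0; have := rb (R a) b.
  by rewrite !RR cRR (lin0 (rb_lin rbR)) scale1r addr0 => <-.
have rR' a b : R (lie a (R b)) = 0.
  by rewrite lieC -scaleN1r (linZ (rb_lin rbR)) rR scaler0.
by have := rb x y; rewrite cRR rR rR' scale1r !add0r.
Qed.

Variables (RU : Uhopf g -> Uhopf g).
Hypothesis hRU : rb_extension R RU.

Let lRU : linear RU := ce_lin (rbh_coalg (rbext_rb hRU)).

Let adU (x : g) (u : Ualg g) : Ualg g := Uin x * u - u * Uin x.

Let adUM x u v : adU x (u * v) = adU x u * v + u * adU x v.
Proof. by rewrite /adU mulrBl mulrBr !mulrA addrA subrK. Qed.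

Let adU_lin x : linear (adU x).
Proof.
move=> a u v; rewrite /adU mulrDr mulrDl -scalerAr -scalerAl opprD addrACA.
by rewrite scalerBr.
Qed.

(** With [foldl] the head of the list acts first, so inductions on [s] can apply the product rule to
    the innermost commutator. *)
Let adUs (s : seq g) (u : Ualg g) := foldl (fun u x => adU (R x) u) u s.

Let adUs_lin s : linear (adUs s).
Proof. by elim: s => [|x s IH] a u v //=; rewrite adU_lin IH. Qed.

Let adU_Uin x z u : adU x (Uin z * u) = Uin (lie x z) * u + Uin z * adU x u.
Proof. by rewrite adUM Uin_lie. Qed.

Let RU_ker z u : R z = 0 -> RU (Uin z * u) = 0.
Proof.
move=> z0; rewrite (rbextM hRU) (rbext_in hRU) z0 (lin0 (@Uin_linear k g)).
by rewrite !mul0r mulr0 subrr (lin0 lRU) subrr.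
Qed.

(* Killing all iterated commutators with R(g), not just the simple ones, is the
   statement that goes through the induction. *)
Let adkilled w := forall s, RU (adUs s w) = 0.

(** The product rule yields two terms of the same shape, since [R] also kills [lie (R x) z]. *)
Let adkilled_ker z u : R z = 0 -> adkilled (Uin z * u).
Proof.
move=> z0 s; elim: s z u z0 => [|x s IH] z u z0 /=; first exact: RU_ker.
by rewrite adU_Uin (linD (adUs_lin _)) (linD lRU) !IH ?addr0 // idem_rb_lie.
Qed.

Let adkilled_mul z w : adkilled w -> adkilled (Uin z * w).
Proof.
move=> kw s; elim: s w kw => [|x s IH] w kw /=.
  (* Both terms of the extension formula vanish: the product by the empty list, the commutator by
     the list [[:: z]]. *)
  rewrite (rbextM hRU) (kw [::]) mulr0 sub0r (rbext_in hRU).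
  by rewrite (kw [:: z]) oppr0.
rewrite adU_Uin (linD (adUs_lin _)) (linD lRU) adkilled_ker ?idem_rb_lie //.
by rewrite IH ?addr0 // => t; apply: (kw (x :: t)).
Qed.

Let adkilled_ad x u : adkilled (adU (R x) u).
Proof.
elim/Ualg_ind: u => [a u v hu hv||z u hu] s.
- by rewrite adU_lin adUs_lin lRU hu hv scaler0 addr0.
- by rewrite /adU mulr1 mul1r subrr (lin0 (adUs_lin s)) (lin0 lRU).
rewrite adU_Uin (linD (adUs_lin _)) (linD lRU) adkilled_ker ?idem_rb_lie //.
by rewrite adkilled_mul // addr0.
Qed.

(** The correction term in [rbextM] is the image of a commutator with $R(x)$, hence zero;
    multiplicativity then spreads from generators as left factors. *)
Lemma idem_rb_ext_am : alg_morph RU.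
Proof.
have RUM x (v : Ualg g) : RU (Uin x * v) = (RU (Uin x) : Ualg g) * RU v.
  rewrite (rbextM hRU) [in X in _ - X](rbext_in hRU).
  by rewrite (adkilled_ad x v [::]) subr0.
suff RM (u v : Ualg g) : RU (u * v) = (RU u : Ualg g) * RU v.
  by split; [exact: lRU|exact: rbext1 hRU|exact: RM].
elim/Ualg_ind: u => [a u u' hu hu'||x u hu].
- by rewrite mulrDl -scalerAl !lRU hu hu' mulrDl scalerAl.
- by rewrite (rbext1 hRU) !mul1r.
- by rewrite -mulrA RUM hu mulrA -RUM.
Qed.

Lemma idem_rb_ext_antipode u : RU (Uantipode u) = Uantipode (RU u).
Proof.
have [_ R1 RM] := idem_rb_ext_am; have sl := @Uantipode_linear k g.
elim/Ualg_ind: u => [a u v hu hv||x u hu].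
- by rewrite sl !lRU sl hu hv.
- by rewrite Uantipode1 R1 Uantipode1.
rewrite UantipodeM !RM UantipodeM hu UantipodeE (rbext_in hRU) UantipodeE.
by rewrite -scaleN1r (linZ lRU) (rbext_in hRU) scaleN1r.
Qed.

End IdempotentExtension.

(** * The central elements $x^p - x^{[p]}$ and stability of their ideal *)

Section RestrictedExtension.
Variables (k : fieldType) (p : nat) (charkp : p \in [pchar k]).
Variables (g : lieAlgType k) (pm R : g -> g).
Hypothesis hR : restricted_rota_baxter p 1 pm R.
Variables (RU : Uhopf g -> Uhopf g).
Hypothesis hRU : rb_extension R RU.

Let lRU : linear RU := ce_lin (rbh_coalg (rbext_rb hRU)).
Let p_gt0 : (0 < p)%N.
Proof. by have /andP[/prime_gt0] := charkp. Qed.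
Let charU : p \in [pchar Ualg g] := pchar_alg charkp (Ualg g).

Definition pcentral (x : g) : Ualg g := Uin x ^+ p - Uin (pm x).

(** On generators, commutation with $x^p$ and with $x^{[p]}$ are both the $p$-fold commutator with
    $x$. *)
Lemma pcentralC x u : pcentral x * u = u * pcentral x.
Proof.
have pc (y : g) : pcentral x * Uin y = Uin y * pcentral x.
  have iterU n : Uin (iter n (lie x) y) =
      iter n (fun u => Uin x * u - u * Uin x) (Uin y).
    by elim: n => //= n <-; rewrite Uin_lie.
  have := iter_mulB_pchar (Uin x) (Uin x) charU (Uin y).
  rewrite -iterU -(pmap_ad (rrb_pmap hR)) Uin_lie => /esym/eqP.
  rewrite subr_eq /pcentral mulrBl mulrBr => /eqP ->.
  by rewrite addrAC [_ * Uin y - _]addrC addrK addrC.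
elim/Ualg_ind: u => [a u v hu hv||y u hu].
- by rewrite mulrDr [RHS]mulrDl -scalerAl -scalerAr hu hv.
- by rewrite mulr1 mul1r.
- by rewrite mulrA pc -mulrA hu mulrA.
Qed.

Lemma rb_ext_pcentral x u : RU (pcentral x * u) = pcentral (R x) * RU u.
Proof.
pose c := Uin (R x); pose s := \sum_(1 <= i < p) jacobson_s p i x (R x).
(* The added commutator of [c] and [v] cancels the correction term of the extension formula. *)
have RUT v : RU ((Uin x + c) * v - v * c) = c * RU v.
  rewrite mulrDl -addrA (linD lRU) (rbextM hRU) (rbext_in hRU) subrK //.
have RUTp : RU (iter p (fun v => (Uin x + c) * v - v * c) u) = c ^+ p * RU u.
  elim: (p) => [|n IH]; first by rewrite expr0 mul1r.
  by rewrite iterS RUT IH exprS mulrA.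
rewrite iter_mulB_pchar // (jacobson_formula charkp (@Uin_linear k g) (@Uin_lie k g)) in RUTp.
have := rbextM hRU (rb_pmap p 1 pm R x) u.
rewrite (rbext_in hRU) (rrbE hR) rb_pmapE // -/s (linD (@Uin_linear k g)) => e2.
(* Centrality of [pcentral (R x)] replaces the commutator with $c^p$ by the one with $R(x)^{[p]}$,
   which cancels against [e2]. *)
have e3 : (Uin x ^+ p + c ^+ p + Uin s) * u - u * c ^+ p =
   pcentral x * u + (Uin (pm x) + Uin s) * u +
   (Uin (pm (R x)) * u - u * Uin (pm (R x))).
  have := pcentralC (R x) u; rewrite /pcentral mulrBl mulrBr => /eqP.
  rewrite subr_eq addrAC -addrA => /eqP eC.
  rewrite /pcentral !mulrDl mulNr eC [Uin x ^+ p * u - _ + _]addrA subrK.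
  by rewrite [_ + Uin s * u]addrAC [u * _ + _]addrC !addrA addrK.
move: RUTp; rewrite -/s e3 2!(linD lRU) e2 -addrA subrK => RUTp.
apply/esym/eqP; rewrite [in X in X == _]/pcentral mulrBl subr_eq; apply/eqP.
exact: esym RUTp.
Qed.

(** [RU] is not multiplicative in general, so the induction over the ideal carries arbitrary factors
    on both sides; centrality brings the generator to the front. *)
Lemma rb_ext_ideal w : u_ideal charkp pm w -> u_ideal charkp pm (RU w).
Proof.
move=> Iw; suff h (u v : Ualg g) : u_ideal charkp pm (RU (u * (w * v))).
  by have := h 1 1; rewrite mulr1 mul1r.
elim: Iw u v => {w} [_ [x]||a x y _ hx _ hy|a x _ h|a x _ h] u v.
- rewrite -/(pcentral x) mulrA -pcentralC -mulrA rb_ext_pcentral.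
  exact/ideal_genMr/ideal_gen_gen/u_pmap.
- by rewrite mul0r mulr0 (lin0 lRU); apply: ideal_gen0.
- rewrite mulrDl mulrDr -scalerAl -scalerAr lRU.
  by apply: ideal_genZD; [apply: hx|apply: hy].
- by rewrite -(mulrA a) (mulrA u); apply: h.
- by rewrite -mulrA; apply: h.
Qed.

End RestrictedExtension.

(** * Descent of endomorphisms to a quotient Hopf algebra *)

Section Descent.
Variables (k : fieldType) (H : cocommHopf k) (I : ideal H).
Hypothesis I_comul :
  forall x, I x -> tmap (qproj I) (qproj I) (comul H x) = 0.
Hypothesis I_counit : forall x, I x -> counit H x = 0.
Hypothesis I_antipode : forall x, I x -> qproj I (antipode H x) = 0.
Let Q : cocommHopf k := hopf_quot I_comul I_counit I_antipode.
Let pj : H -> Q := qproj I.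

Let pj_am : alg_morph pj := qproj_am I.
Let pl : linear pj := am_lin pj_am.
Let pj_ind (P : Q -> Prop) : (forall x, P (pj x)) -> forall q, P q.
Proof. exact: qproj_ind. Qed.

Definition trilin (X W : lmodType k) (f : X -> X -> X -> W) :=
  (forall a, bilin (f a)) /\ (forall b c, linear (fun a => f a b c)).

Lemma trilin_tlift (X W : lmodType k) (f : X -> X -> X -> W) : trilin f ->
  bilin (fun a bc => tlift (f a) bc).
Proof.
move=> [bf lf]; split=> [bc|a]; last exact: tlift_linear.
exact: tlift_param.
Qed.

(** The projection respects comultiplication, and both sides are linear in each of the two
    coproducts, so pure tensors suffice. *)
Lemma sweedler3_proj (f : Q -> Q -> Q -> Q) (f' : H -> H -> H -> H) x :
  trilin f -> trilin f' -> (forall a b c, f (pj a) (pj b) (pj c) = pj (f' a b c)) ->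
  sweedler3 f (pj x) = pj (sweedler3 f' x).
Proof.
move=> tf tf' ff'.
have cl := am_lin (comul_am H); have ql := am_lin (comul_am Q).
have bf := trilin_tlift tf; have bf' := trilin_tlift tf'.
have il (V : lmodType k) := @id_lin k V.
rewrite /sweedler3 [comul Q (pj x)](qcomulE I_comul).
move: (comul H x); apply: eq_tens.
- by apply: comp_lin; [apply: tlift_linear|apply: comp_lin; apply: tmap_linear].
- by apply: comp_lin => //; apply: comp_lin; [apply: tlift_linear|apply: tmap_linear].
move=> a b; rewrite !tmapE // (tliftE bf) (tliftE bf') [comul Q _](qcomulE I_comul).
move: (comul H b); apply: eq_tens.
- by apply: comp_lin; [apply: tlift_linear; apply: tf.1|apply: tmap_linear].
- by apply: comp_lin => //; apply: tlift_linear; apply: tf'.1.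
by move=> c d; rewrite tmapE // (tliftE (tf.1 _)) (tliftE (tf'.1 _)) ff'.
Qed.

Lemma rb_trilin (K : cocommHopf k) (R : K -> K) y : linear R ->
  trilin (fun a b c => a * R b * y * antipode K (R c)).
Proof.
move=> lR; have sl := @antipode_lin k K; split=> [a|b c d u v].
  split=> [c d u v|b d u v].
    by rewrite lR mulrDr !mulrDl -scalerAr -!scalerAl.
  by rewrite lR sl mulrDr -scalerAr.
by rewrite !mulrDl -!scalerAl.
Qed.

Variable R : H -> H.
Hypothesis R_lin : linear R.
Hypothesis R_ideal : forall x, I x -> I (R x).

Definition quot_endo : Q -> Q := qlift I (fun x => pj (R x)).

Let pjRl : linear (fun x => pj (R x)).
Proof. exact: comp_lin. Qed.

Let pjR0 x : I x -> pj (R x) = 0.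
Proof.
move=> Ix; rewrite -(lin0 pl) /pj qprojE; apply/qpiP.
by rewrite subr0; apply: R_ideal.
Qed.

Lemma quot_endoE x : quot_endo (pj x) = pj (R x).
Proof. exact: (qlift_proj x pjRl pjR0). Qed.

Lemma quot_endo_lin : linear quot_endo.
Proof. exact: qlift_linear pjRl pjR0. Qed.

Lemma quot_endo_coalg : coalg_endo R -> coalg_endo quot_endo.
Proof.
move=> cR; split; first exact: quot_endo_lin.
  elim/pj_ind=> x; rewrite quot_endoE.
  rewrite ![comul Q _](qcomulE I_comul) (ce_comul cR) !tmap_comp //; try exact: quot_endo_lin.
  by congr (tmap _ _ _); apply/funext => y; rewrite quot_endoE.
elim/pj_ind=> x; rewrite quot_endoE.
by rewrite ![counit Q _](qcounitE I_counit) (ce_counit cR).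
Qed.

Lemma quot_endo_rb : rota_baxter_hopf R -> rota_baxter_hopf quot_endo.
Proof.
move=> rR; split; first exact/quot_endo_coalg/(rbh_coalg rR).
elim/pj_ind=> x; elim/pj_ind=> y.
rewrite !quot_endoE -(amM pj_am) (rbhE rR) -quot_endoE; congr (quot_endo _).
apply/esym; apply: sweedler3_proj; [exact/rb_trilin/quot_endo_lin|exact: rb_trilin|].
move=> a b c; rewrite !quot_endoE [antipode Q _](qantipodeE I_antipode).
by rewrite !(amM pj_am).
Qed.

Lemma quot_endo_hopf : hopf_endo R -> hopf_endo quot_endo.
Proof.
move=> [[_ R1 RM] cR aR]; split; last 1 first.
- elim/pj_ind=> x; rewrite quot_endoE.
  by rewrite ![antipode Q _](qantipodeE I_antipode) quot_endoE aR.
- split; first exact: quot_endo_lin.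
    by rewrite -(am1 pj_am) quot_endoE R1.
  elim/pj_ind=> x; elim/pj_ind=> y.
  by rewrite -(amM pj_am) !quot_endoE RM (amM pj_am).
exact: quot_endo_coalg.
Qed.

End Descent.

(** * The induced operator on the restricted enveloping algebra *)

Theorem theorem4p18 (k : closedFieldType) (p : nat) (charkp : p \in [pchar k])
    (g : lieAlgType k) (pm R : g -> g)
    (hR : restricted_rota_baxter p 1 pm R)
    (RU : Uhopf g -> Uhopf g) (hRU : rb_extension R RU) :
  exists Ru : uhopf charkp pm -> uhopf charkp pm,
    [/\ forall x : Uhopf g, Ru (u_proj charkp pm x) = u_proj charkp pm (RU x),
        rota_baxter_hopf Ru
      & (forall x, R (R x) = R x) -> p <> 2%N -> hopf_endo Ru].
Proof.
have lRU := ce_lin (rbh_coalg (rbext_rb hRU)).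
have IRU := rb_ext_ideal (charkp := charkp) hR hRU.
exists (@quot_endo k (Uhopf g) (u_ideal charkp pm) (u_ideal_comul (pm:=pm))
  (u_ideal_counit (pm:=pm)) (u_ideal_antipode (pm:=pm)) RU); split.
- by move=> x; apply: quot_endoE.
- exact: quot_endo_rb lRU IRU (rbext_rb hRU).
move=> RR p2; apply: quot_endo_hopf => //.
(* If 2 were zero, $p$ would divide 2 and hence equal it. *)
have k2 : 2%:R != 0 :> k.
  rewrite -(dvdn_pcharf charkp); apply/negP => /dvdn_leq => /(_ isT) p_le2.
  have /andP[/prime_gt1 p_gt1 _] := charkp.
  by apply: p2; apply/eqP; rewrite eqn_leq p_le2.
have rbR := rrb_rb hR.
split; [exact: idem_rb_ext_am rbR RR k2 _ hRU|exact: rbh_coalg (rbext_rb hRU)|].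
exact: idem_rb_ext_antipode rbR RR k2 _ hRU.
Qed.
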